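(* Consider the Erlang-C system. For all integers $n\ge 1$ and all $\lambda>0$, $\mu>0$ satisfying $1\le R<n$, $$d_W(\tilde X(\infty),Y(\infty)) := \sup_{h\in \mathrm{Lip}(1)}\big|\mathbb{E}h(\tilde X(\infty))-\mathbb{E}h(Y(\infty))\big|\le \frac{190}{\sqrt{R}} .$$
   Context: Erlang-C system: $n$ homogeneous servers, Poisson arrivals with rate $\lambda$, i.i.d. exponential service times with mean $1/\mu$, first-come-first-serve, infinite buffer, no abandonment. The customer count $X=\{X(t),t\ge 0\}$ is the birth-death process on $\{0,1,2,\dots\}$ with birth rate $\lambda$ in every state and death rate $\mu (k\wedge n)$ in state $k$. The offered load is $R=\lambda/\mu$; when $R<n$, $X$ is positive recurrent, and $X(\infty)$ denotes a random variable with its stationary distribution. Set $\tilde X(\infty)=(X(\infty)-R)/\sqrt R$ and $\zeta=(R-n)/\sqrt R$. For $x\in\mathbb{R}$ let $x^-=\max(-x,0)$ and $b(x)=\big((x+\zeta)^--\zeta^-\big)\mu$. $Y(\infty)$ is a continuous random variable on $\mathbb{R}$ with density $\kappa\exp\big(\frac1\mu\int_0^x b(y)\,dy\big)$, where $\kappa>0$ is the normalizing constant. $\mathrm{Lip}(1)=\{h:\mathbb{R}\to\mathbb{R}: |h(x)-h(y)|\le|x-y| \text{ for all } x,y\in\mathbb{R}\}$. *)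

(* Defs.v *)
From mathcomp Require Import all_boot all_order all_algebra.
From mathcomp Require Import all_classical all_reals all_analysis.
Set Implicit Arguments.
Unset Strict Implicit.
Unset Printing Implicit Defensive.
Import Order.TTheory GRing.Theory Num.Theory.
Import numFieldNormedType.Exports.
Local Open Scope classical_set_scope.
Local Open Scope ring_scope.

(* [birth_death_rate birth death i j] is the (i, j) entry of the rate matrix;
   it is meant for death rates with [death 0 = 0]. *)
Definition birth_death_rate (R : realType) (birth death : nat -> R)
    (i j : nat) : R :=
  if j == i.+1 then birth i
  else if i == j.+1 then death i
  else if i == j then - (birth i + death i)
  else 0.

(* [p t i j] is P(X(s + t) = j | X(s) = i) for a time-homogeneous
   continuous-time Markov chain X on nat with rate matrix [q]. The law of the
   chain enters only through [p]; for bounded rates, [p] is determined by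
   [q]. *)
Record markov_transition (R : realType) (q : nat -> nat -> R)
    (p : R -> nat -> nat -> R) : Prop := MarkovTransition {
  transition0 : forall i j, p 0 i j = (i == j)%:R;
  transition_ge0 : forall (t : R) i j, 0 <= t -> 0 <= p t i j;
  transition_sum1 : forall (t : R) i, 0 <= t ->
    (\sum_(0 <= j <oo) (p t i j)%:E = 1)%E;
  transitionD : forall (s t : R) i j, 0 <= s -> 0 <= t ->
    ((p (s + t) i j)%:E = \sum_(0 <= k <oo) (p s i k)%:E * (p t k j)%:E)%E;
  transition_rate : forall i j,
    (p t i j - (i == j)%:R) / t @[t --> 0^'+] --> q i j
}.

Definition stationary_distribution (R : realType) (p : R -> nat -> nat -> R)
    (nu : probability nat R) : Prop :=
  forall (t : R) j, 0 <= t ->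
    (nu [set j] = \sum_(0 <= i <oo) nu [set i] * (p t i j)%:E)%E.

Definition erlangC_rate (R : realType) (n : nat) (lambda mu : R) :
    nat -> nat -> R :=
  birth_death_rate (fun=> lambda) (fun k => mu * (minn k n)%:R).

Definition offered_load (R : realType) (lambda mu : R) : R := lambda / mu.

Definition scaled_count (R : realType) (lambda mu : R) (k : nat) : R :=
  (k%:R - offered_load lambda mu) / Num.sqrt (offered_load lambda mu).

Definition neg_part (R : realType) (x : R) : R := Num.max (- x) 0.

Definition zeta (R : realType) (n : nat) (lambda mu : R) : R :=
  (offered_load lambda mu - n%:R) / Num.sqrt (offered_load lambda mu).

Definition drift (R : realType) (n : nat) (lambda mu x : R) : R :=
  (neg_part (x + zeta n lambda mu) - neg_part (zeta n lambda mu)) * mu.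

(* The library's integrals are over sets, so the sign of the integral from [a]
   to [b] when [b < a] has to be put in by hand. *)
Definition oriented_integral (R : realType) (f : R -> R) (a b : R) : R :=
  if a <= b then \int[lebesgue_measure]_(y in `[a, b]) f y
  else - \int[lebesgue_measure]_(y in `[b, a]) f y.

Definition diffusion_density (R : realType) (n : nat) (lambda mu kappa x : R)
    : R :=
  kappa * expR (mu^-1 * oriented_integral (drift n lambda mu) 0 x).

Definition has_density d (T : measurableType d) (R : realType)
    (P : probability T R) (Y : {RV P >-> R}) (f : R -> R) : Prop :=
  forall A : set R, measurable A ->
    distribution P Y A = (\int[lebesgue_measure]_(x in A) (f x)%:E)%E.

Definition Lip1 (R : realType) : set (R -> R) :=
  [set h | forall x y, `|h x - h y| <= `|x - y|].

(* In [\bar R], oo - oo is -oo, whose absolute value is +oo: an undefined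
   expectation makes this distance infinite and never small. *)
Definition wasserstein (R : realType) d1 (T1 : measurableType d1)
    (P1 : probability T1 R) (U : T1 -> R) d2 (T2 : measurableType d2)
    (P2 : probability T2 R) (V : T2 -> R) : \bar R :=
  ereal_sup [set `| 'E_P1[h \o U] - 'E_P2[h \o V] |%E | h in @Lip1 R].

(* Main.v *)
Require Import Defs.
From HB Require Import structures.
From mathcomp Require Import all_boot all_order all_algebra.
From mathcomp Require Import all_classical all_reals all_analysis.
From mathcomp Require Import measurable_realfun.
From mathcomp Require Import ring lra zify.
Import Order.TTheory GRing.Theory Num.Theory.
Import numFieldNormedType.Exports.
Local Open Scope classical_set_scope.
Local Open Scope ring_scope.
Set Implicit Arguments.
Unset Strict Implicit.
Unset Printing Implicit Defensive.

(** Write [q] for the square root of the offered load, [x k = (k - q^2) / q]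
for the scaled states, which are [1/q] apart, [a = - zeta] for the scaled
number of servers and [s y = min y a], so that the diffusion has drift
[- mu * s]. Its stationary density is a multiple of [exp (- S)] with [S' = s]:
Gaussian up to [a], exponential with rate [a] beyond.

The proof is a first-order form of Stein's method. Let [h] be 1-Lipschitz,
[c] the mean of [h] under the diffusion and [phi = h - c]. The
solution [g] of [g' = phi + s g] is the integral of [phi] against the density
up to the current point, divided by the density. Detailed balance gives,
for every [G] of moderate growth, that the mean of
[q (G (x (k+1)) - G (x k)) - s (x k) G (x k)] under the law of the chain is
zero ([discrete_stein_identity]). Taking [G = g] and subtracting, the mean of
[phi] under the chain is, up to sign, the mean of the secant error
[q (g (x + 1/q) - g x) - g' x], which the mean value theorem bounds by the
oscillation of [g'] over a step of length [1/q].

Everything therefore rests on a Lipschitz bound for [g']. A translate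
difference [g (x + t) - g x] solves the same equation with a source of size
[O(t)], so one comparison principle ([stein_norm_le_left] and its variants)
bounds first [g] and then its increments ([stein_derivative_increment],
[stein_derivative_increment_exponential_regime]). The Lipschitz constant is 2
beyond [a], and is of order [1 + 1/a] below [a], because the mean absolute
value of the diffusion is at most [1 + 1/a] ([diffusion_first_moment]). When
[a] is small this blow-up is paid for by the chain seldom being below [a]: the
probability of an idle server is at most [2 a] ([mass_below_le]). The two
factors together leave a total of [100 / q] ([grid_mean_source_le]).

The law of the chain enters only through detailed balance, which follows from
stationarity by letting time tend to zero ([stationary_detailed_balance]). *)

(** * Comparison principle for the first-order Stein equation *)

Section comparison.
Context (R : realType).

Lemma is_derive_ge0_le (f df : R -> R) (l r : R) : l <= r ->
  (forall x : R, is_derive x 1 f (df x)) ->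
  (forall x, l < x < r -> 0 <= df x) -> f l <= f r.
Proof.
move=> lr f' df_ge0; move: lr; rewrite le_eqVlt => /predU1P[->//|lr].
have fc : {within `[l, r], continuous f}.
  apply: continuous_subspaceT => x.
  exact/differentiable_continuous/derivable1_diffP.
have [x xlr E] := MVT lr (fun x _ => f' x) fc.
by rewrite -subr_ge0 E mulr_ge0 ?subr_ge0 ?(ltW lr)// df_ge0.
Qed.

(** Decay at both ends at once: the comparison from the left and the one from
the right then use the same hypothesis. *)
Definition vanishes (f : R -> R) :=
  forall e, 0 < e -> exists M, forall x, M <= `|x| -> `|f x| <= e.

Context (s S : R -> R) (S' : forall x : R, is_derive x 1 S (s x)).

(** Besides the solution that decays against the weight [exp (- S)], the
equation has the solutions obtained by adding multiples of [exp S]; the decay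
condition singles out the one that Stein's method needs. *)
Definition stein_solution (u phi : R -> R) :=
  (forall x : R, is_derive x 1 u (phi x + s x * u x)) /\
  vanishes (fun x => u x * expR (- S x)).

Lemma stein_solutionN u phi : stein_solution u phi ->
  stein_solution (fun x => - u x) (fun x => - phi x).
Proof.
move=> [u' uv]; split=> [x|e e0].
  have u'x := u' x.
  by apply: is_derive_eq; rewrite mulrN opprD.
by have [M HM] := uv _ e0; exists M => x /HM; rewrite mulNr normrN.
Qed.

(** Multiplying by the integrating factor [exp (- S)] turns the differential
inequality between a barrier [B] and a solution [u] into monotonicity of the
weighted gap. *)
Lemma weighted_gap_le (u phi B dB : R -> R) (l r : R) : l <= r ->
  stein_solution u phi -> (forall x : R, is_derive x 1 B (dB x)) ->
  (forall x, l < x < r -> phi x <= dB x - s x * B x) ->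
  (B l - u l) * expR (- S l) <= (B r - u r) * expR (- S r).
Proof.
move=> lr [u' _] B' phi_le.
pose df x := (dB x - s x * B x - phi x) * expR (- S x).
apply: (@is_derive_ge0_le (fun x => (B x - u x) * expR (- S x)) df) => //.
  move=> x; have u'x := u' x; have B'x := B' x; have S'x := S' x.
  apply: is_derive_eq; rewrite /df /GRing.scale/=; ring.
by move=> x /phi_le; rewrite /df => phix; rewrite mulr_ge0 ?expR_ge0// subr_ge0.
Qed.

(** At infinity the weighted solution dies out, so the weighted gap of a
nonnegative barrier is asymptotically nonnegative. *)
Lemma vanishing_gap_ge0 u phi (B : R -> R) (v : R) (P : R -> Prop) :
  stein_solution u phi ->
  (forall M, exists2 y, M <= `|y| & P y) ->
  (forall y, P y -> 0 <= B y) ->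
  (forall y, P y -> (B y - u y) * expR (- S y) <= v) -> 0 <= v.
Proof.
move=> [_ uv] far B_ge0 gap_le; rewrite -oppr_le0; apply/ler_addgt0Pr => e e0.
have [M HM] := uv _ e0; have [y /HM uy Py] := far M.
have := gap_le _ Py; have : 0 <= B y * expR (- S y).
  by rewrite mulr_ge0 ?expR_ge0 ?B_ge0.
by move: uy; rewrite mulrBl ler_norml; lra.
Qed.

Lemma stein_le_left (u phi B dB : R -> R) (r : R) :
  stein_solution u phi -> (forall x : R, is_derive x 1 B (dB x)) ->
  (forall x, x < r -> 0 <= B x) ->
  (forall x, x < r -> phi x <= dB x - s x * B x) -> u r <= B r.
Proof.
move=> us B' B_ge0 phi_le; rewrite -subr_ge0.
rewrite -(pmulr_lge0 _ (expR_gt0 (- S r))).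
apply: (@vanishing_gap_ge0 u phi B _ (fun y => y < r)) => //.
- move=> M; exists (- `|M| - `|r| - 1).
    rewrite ler0_norm; first by rewrite !opprB opprK; have := ler_norm M;
      have := normr_ge0 r; lra.
    by have := normr_ge0 M; have := normr_ge0 r; lra.
  by have := normr_ge0 M; have := ler_norm (- r); rewrite normrN; lra.
- move=> y yr; apply: (@weighted_gap_le _ phi _ dB) => //; first exact: ltW.
  by move=> x /andP[_]; exact: phi_le.
Qed.

Lemma stein_le_right (u phi B dB : R -> R) (l : R) :
  stein_solution u phi -> (forall x : R, is_derive x 1 B (dB x)) ->
  (forall x, l < x -> 0 <= B x) ->
  (forall x, l < x -> phi x <= s x * B x - dB x) -> - u l <= B l.
Proof.
move=> us B' B_ge0 phi_le.
rewrite -subr_ge0 opprK -(pmulr_lge0 _ (expR_gt0 (- S l))).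
apply: (@vanishing_gap_ge0 _ _ B _ (fun y => l < y) (stein_solutionN us)) => //.
- move=> M; exists (`|M| + `|l| + 1).
    rewrite ger0_norm; first by have := ler_norm M; have := normr_ge0 l; lra.
    by have := normr_ge0 M; have := normr_ge0 l; lra.
  by have := normr_ge0 M; have := ler_norm l; lra.
- move=> y ly.
  have B'N (x : R) : is_derive x 1 (fun x => - B x) (- dB x).
    by have B'x := B' x; apply: is_derive_eq.
  rewrite -lerN2 -!mulNr !opprD !opprK.
  apply: (@weighted_gap_le _ phi (fun x => - B x) _ _ _ (ltW ly) us B'N).
  by move=> x /andP[/phi_le]; lra.
Qed.

Lemma stein_le_forward (u phi B dB : R -> R) (l r : R) : l <= r ->
  stein_solution u phi -> (forall x : R, is_derive x 1 B (dB x)) ->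
  u l <= B l ->
  (forall x, l < x < r -> phi x <= dB x - s x * B x) -> u r <= B r.
Proof.
move=> lr us B' uBl phi_le; rewrite -subr_ge0.
rewrite -(pmulr_lge0 _ (expR_gt0 (- S r))).
apply: le_trans (@weighted_gap_le u phi B dB l r lr us B' phi_le).
by rewrite mulr_ge0 ?expR_ge0// subr_ge0.
Qed.

Lemma stein_le_backward (u phi B dB : R -> R) (l r : R) : l <= r ->
  stein_solution u phi -> (forall x : R, is_derive x 1 B (dB x)) ->
  - u r <= B r ->
  (forall x, l < x < r -> phi x <= s x * B x - dB x) -> - u l <= B l.
Proof.
move=> lr us B' uBr phi_le.
have B'N (x : R) : is_derive x 1 (fun x => - B x) (- dB x).
  by have B'x := B' x; apply: is_derive_eq.
rewrite -subr_ge0 opprK -(pmulr_lge0 _ (expR_gt0 (- S l))) -oppr_le0 -mulNr opprD.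
apply: (@le_trans _ _ ((- B r - u r) * expR (- S r))).
  apply: (@weighted_gap_le u phi (fun x => - B x) _ l r lr us B'N) => x.
  by move=> /phi_le; rewrite mulrN opprK addrC.
by rewrite pmulr_lle0 ?expR_gt0//; lra.
Qed.

(** A barrier on a left half-line needs no boundary value: decay at minus
infinity replaces it. The three variants below start from plus infinity, from
a left end point and from a right end point. *)
Lemma stein_norm_le_left (u phi B dB : R -> R) (r : R) :
  stein_solution u phi -> (forall x : R, is_derive x 1 B (dB x)) ->
  (forall x, x < r -> 0 <= B x) ->
  (forall x, x < r -> `|phi x| <= dB x - s x * B x) -> `|u r| <= B r.
Proof.
move=> us B' B_ge0 phi_le; rewrite ler_norml lerNl; apply/andP; split.
  apply: (@stein_le_left _ _ B dB r (stein_solutionN us)) => // x /phi_le.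
  by rewrite ler_norml; lra.
apply: (@stein_le_left _ _ B dB r us) => // x /phi_le.
by rewrite ler_norml; lra.
Qed.

Lemma stein_norm_le_right (u phi B dB : R -> R) (l : R) :
  stein_solution u phi -> (forall x : R, is_derive x 1 B (dB x)) ->
  (forall x, l < x -> 0 <= B x) ->
  (forall x, l < x -> `|phi x| <= s x * B x - dB x) -> `|u l| <= B l.
Proof.
move=> us B' B_ge0 phi_le; rewrite ler_norml lerNl; apply/andP; split.
  apply: (@stein_le_right _ _ B dB l us) => // x /phi_le.
  by rewrite ler_norml; lra.
rewrite -[u l]opprK.
apply: (@stein_le_right _ _ B dB l (stein_solutionN us)) => // x /phi_le.
by rewrite ler_norml; lra.
Qed.

Lemma stein_norm_le_forward (u phi B dB : R -> R) (l r : R) : l <= r ->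
  stein_solution u phi -> (forall x : R, is_derive x 1 B (dB x)) ->
  `|u l| <= B l ->
  (forall x, l < x < r -> `|phi x| <= dB x - s x * B x) -> `|u r| <= B r.
Proof.
rewrite ler_norml => lr us B' /andP[ul1 ul2] phi_le.
rewrite ler_norml lerNl; apply/andP; split.
  apply: (@stein_le_forward _ _ B dB l r lr (stein_solutionN us)) => //.
    by rewrite lerNl.
  by move=> x /phi_le; rewrite ler_norml; lra.
apply: (@stein_le_forward _ _ B dB l r lr us) => // x /phi_le.
by rewrite ler_norml; lra.
Qed.

Lemma stein_norm_le_backward (u phi B dB : R -> R) (l r : R) : l <= r ->
  stein_solution u phi -> (forall x : R, is_derive x 1 B (dB x)) ->
  `|u r| <= B r ->
  (forall x, l < x < r -> `|phi x| <= s x * B x - dB x) -> `|u l| <= B l.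
Proof.
rewrite ler_norml => lr us B' /andP[ur1 ur2] phi_le.
rewrite ler_norml lerNl; apply/andP; split.
  apply: (@stein_le_backward _ _ B dB l r lr us) => //; first by rewrite lerNl.
  by move=> x /phi_le; rewrite ler_norml; lra.
rewrite -[u l]opprK.
apply: (@stein_le_backward _ _ B dB l r lr (stein_solutionN us)) => //.
  by rewrite opprK.
by move=> x /phi_le; rewrite ler_norml; lra.
Qed.

(** Translating the equation shows that an increment of a solution is again a
solution. Its source involves increments of [phi] and [s] only, never a
derivative of [phi]; this is how second derivatives of [u] are avoided. *)
Lemma stein_solution_increment (u phi : R -> R) (t C : R) :
  (forall x, S (x + t) - S x <= C) -> stein_solution u phi ->
  stein_solution (fun x => u (x + t) - u x)
    (fun x => phi (x + t) - phi x + (s (x + t) - s x) * u (x + t)).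
Proof.
move=> S_le [u' uv]; split=> [x|e e0].
  have u'x := u' x; have u'xt := u' (x + t).
  have -> : (fun x => u (x + t) - u x) = (u \o shift t) - u by [].
  apply: is_derive_eq.
  rewrite /GRing.scale/=; ring.
(* [expR C] bounds the ratio of the weights at [x] and at [x + t]. *)
pose d := e / (1 + expR C).
have d0 : 0 < d by rewrite divr_gt0// addr_gt0// expR_gt0.
have [M HM] := uv _ d0; exists (M + `|t|) => x Mx.
rewrite mulrBl (le_trans (ler_normB _ _))//.
have -> : e = expR C * d + d.
  by rewrite /d; field; rewrite gt_eqF// addr_gt0// expR_gt0.
apply: lerD; last by apply: HM; have := normr_ge0 t; lra.
have -> : expR (- S x) = expR (S (x + t) - S x) * expR (- S (x + t)).
  by rewrite -expRD; congr expR; ring.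
rewrite mulrCA normrM ger0_norm ?expR_ge0//.
apply: ler_pM; rewrite ?expR_ge0 ?ler_expR//; apply: HM.
by have := ler_normB (x + t) t; rewrite addrK; lra.
Qed.

End comparison.

(** * Bounds on the Stein solution for a drift capped at a threshold *)

Section piecewise_potential.
Context (R : realType) (a : R).

(** The antiderivative of [min y a] vanishing at 0, in a form that is
manifestly continuously differentiable across [a]. *)
Definition potential (x : R) := x ^+ 2 / 2 - (Num.max (x - a) 0) ^+ 2 / 2.

(** Spares a separate discussion of one-sided derivatives at the junction of a
piecewise polynomial. *)
Lemma is_derive_quadratic_error (f : R -> R) (x d C : R) :
  (forall y, `|f y - f x - d * (y - x)| <= C * (y - x) ^+ 2) ->
  is_derive x 1 f d.
Proof.
move=> f_le.
have C_ge0 : 0 <= C.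
  have := f_le (x + 1); have -> : x + 1 - x = 1 by ring.
  by rewrite expr1n !mulr1; apply: le_trans (normr_ge0 _).
have lim : h^-1 *: (f (h *: 1 + x) - f x) @[h --> 0^'] --> d.
  apply/cvgrPdist_le => /= e e0.
  near=> h.
  have h0 : h != 0 by near: h; exact: nbhs_dnbhs_neq.
  have -> : d - h^-1 *: (f (h *: 1 + x) - f x)
      = - (h^-1 * (f (h + x) - f x - d * (h + x - x))).
    by rewrite /GRing.scale/= mulr1; field.
  rewrite normrN normrM normfV ler_pdivrMl ?normr_gt0//.
  rewrite (le_trans (f_le _))// addrK -real_normK ?num_real// expr2 mulrCA.
  rewrite ler_wpM2l// (@le_trans _ _ (C * (e / (C + 1))))//.
    by rewrite ler_wpM2l//; near: h; apply: dnbhs0_le; rewrite divr_gt0//; lra.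
  rewrite mulrCA ler_piMr ?(ltW e0)// ler_pdivrMr; lra.
apply: DeriveDef; first by apply/cvg_ex; exists d.
by apply/cvg_lim.
Unshelve. all: by end_near. Qed.

Lemma is_derive_potential (x : R) : is_derive x 1 potential (Num.min x a).
Proof.
apply: (@is_derive_quadratic_error _ _ _ 1) => y.
rewrite /potential ler_norml; have sq := sqr_ge0 (y - x).
have [xa|ax] := leP x a; have [ya|ay] := leP y a.
- by rewrite !max_r; [apply/andP; split; nra|lra..].
- rewrite (max_l (x := y - a)) 1?max_r; [|lra..].
  have : (y - a) ^+ 2 <= (y - x) ^+ 2 by rewrite ler_sqr ?nnegrE; lra.
  by move=> h; apply/andP; split; nra.
- rewrite (max_r (x := y - a)) 1?max_l; [|lra..].
  have : (a - y) ^+ 2 <= (x - y) ^+ 2 by rewrite ler_sqr ?nnegrE; lra.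
  by move=> h; apply/andP; split; nra.
- by rewrite !max_l; [apply/andP; split; nra|lra..].
Qed.

Lemma potential_increment (x t : R) : 0 <= t ->
  potential (x + t) - potential x <= a * t.
Proof.
rewrite /potential => t0.
have [xa|ax] := leP x a; have [ya|ay] := leP (x + t) a.
- by rewrite !max_r; [nra|lra..].
- by rewrite (max_l (x := x + t - a)) 1?max_r; [nra|lra..].
- lra.
- by rewrite !max_l; [nra|lra..].
Qed.
End piecewise_potential.

Section erlangC_stein_bounds.
Context (R : realType) (a : R) (a_gt0 : 0 < a).
Context (K : R) (K_ge1 : 1 <= K) (K_geV : a^-1 <= K) (g phi : R -> R).
Context (g_sol : stein_solution (fun x => Num.min x a) (potential a) g phi).
Context (phi_lip : forall x y, `|phi x - phi y| <= `|x - y|).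
Context (phi_le : forall x, `|phi x| <= `|x| + K).

Let S' := @is_derive_potential R a.

(** Far to the left the constant [1 + K] is a barrier, since there the drift
term [- y] times it dominates [- y + K]. *)
Lemma stein_bound_left_tail (x : R) : x <= -1 -> `|g x| <= 1 + K.
Proof.
have [[a0 K1] Ka] := (a_gt0, K_ge1, K_geV).
move=> x1; apply: (@stein_norm_le_left _ _ _ S' g phi (cst (1 + K)) (cst 0)) => //.
- by move=> y _; rewrite /cst; lra.
- move=> y yx; apply: le_trans (phi_le y) _; rewrite /= min_l; last by lra.
  have y1 : y <= -1 by lra.
  have K0 : 0 <= K by lra.
  by rewrite ler0_norm; [nra|lra].
Qed.

(** Near 0 the drift has no sign to exploit, so the barrier must grow. A cubic
starting from the value [1 + K] at -1 is enough. *)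
Lemma stein_bound_center (x : R) : -1 <= x -> x <= 1 -> x <= a ->
  `|g x| <= 11 * (1 + K).
Proof.
have [[a0 K1] Ka] := (a_gt0, K_ge1, K_geV).
move=> x1 x2 xa.
(* [dB - y * B - (1 + K)] is [(1 + K)] times
   [(1 - y^2) (3 + 3 y + 2 y^2) + y^4], and [B 1 = 11 (1 + K)]. *)
pose B (y : R) := ((y + 1) ^+ 3 + (y + 1) + 1) * (1 + K).
pose dB (y : R) := (3 * (y + 1) ^+ 2 + 1) * (1 + K).
apply: (@le_trans _ _ (B x)); last by rewrite /B; apply: ler_wpM2r; [lra|nra].
have B' (y : R) : is_derive y 1 B (dB y).
  rewrite /B; apply: is_derive_eq.
  by rewrite /dB /GRing.scale/=; ring.
apply: (@stein_norm_le_forward _ _ _ S' g phi B dB (-1) x x1 g_sol B').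
  by rewrite /B addNr expr0n/= !add0r mul1r stein_bound_left_tail.
move=> y /andP[y1 yx]; apply: le_trans (phi_le y) _; rewrite min_l; last by lra.
have : `|y| <= 1 by rewrite ler_norml; apply/andP; split; lra.
set z := `|y|; clearbody z => z1.
have -> : dB y - y * B y = (4 + 3 * y - y ^+ 2 - 3 * y ^+ 3 - y ^+ 4) * (1 + K).
  by rewrite /dB /B; ring.
apply: (@le_trans _ _ (1 * (1 + K))); first lra.
apply: ler_wpM2r; first lra.
have -> : 4 + 3 * y - y ^+ 2 - 3 * y ^+ 3 - y ^+ 4
  = 1 + (1 - y ^+ 2) * (3 + 3 * y + 2 * y ^+ 2) + (y ^+ 2) ^+ 2 by ring.
have : 0 <= 1 - y ^+ 2 by nra.
have : 0 <= 3 + 3 * y + 2 * y ^+ 2 by nra.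
have := sqr_ge0 (y ^+ 2); nra.
Qed.

(** In the exponential regime the linear source [y + K] is matched exactly by
a linear barrier. *)
Lemma stein_bound_exponential_regime (x : R) : a <= x -> `|g x| <= (x + K) / a + a^-2.
Proof.
have [[a0 K1] Ka] := (a_gt0, K_ge1, K_geV).
have ia_gt0 : 0 < a^-1 by rewrite invr_gt0.
move=> ax; rewrite -exprVn.
pose B (y : R) := (y + K) * a^-1 + a^-1 ^+ 2.
apply: (@stein_norm_le_right _ _ _ S' g phi B (cst a^-1) x) => //.
- by move=> y; rewrite /B; apply: is_derive_eq; rewrite /GRing.scale/=; ring.
- by move=> y xy; rewrite /B addr_ge0 ?sqr_ge0// mulr_ge0//; lra.
- move=> y xy; apply: le_trans (phi_le y) _; rewrite min_r; last by lra.
  rewrite ger0_norm; last by lra.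
  rewrite /B /= le_eqVlt; apply/orP; left; apply/eqP; field; lra.
Qed.

(** When [a] exceeds 1, the points between 1 and [a] are reached backwards from
[a] with a constant barrier, because there [s] is at least 1. *)
Lemma stein_bound_gaussian_regime (x : R) : x <= a -> `|g x| <= 11 * (1 + K).
Proof.
have [[a0 K1] Ka] := (a_gt0, K_ge1, K_geV).
move=> xa; have [x1|x1] := leP x (-1).
  by apply: le_trans (stein_bound_left_tail x1) _; lra.
have [x2|x2] := leP x 1; first by rewrite stein_bound_center// ltW.
suff gx : `|g x| <= cst (2 + K) x by apply: le_trans gx _; rewrite /cst; lra.
apply: (@stein_norm_le_backward _ _ _ S' g phi (cst (2 + K)) (cst 0) x a) => //.
  apply: le_trans (stein_bound_exponential_regime (lexx a)) _ => /=.
  have ia_gt0 : 0 < a^-1 by rewrite invr_gt0.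
  have ia1 : a^-1 <= 1 by rewrite invf_le1; lra.
  rewrite mulrDl mulfV ?gt_eqF//.
  have -> : a^-2 = a^-1 * a^-1 by rewrite -expr2 exprVn.
  nra.
move=> y /andP[xy ya]; apply: le_trans (phi_le y) _; rewrite min_l; last by lra.
rewrite ger0_norm /=; [nra|lra].
Qed.

Let g_incr (t : R) (t_ge0 : 0 <= t) :=
  stein_solution_increment (fun x => potential_increment a x t_ge0) g_sol.

(** Beyond [a] the drift is constant, so the source of the increment equation
is the increment of [phi] alone. *)
Lemma stein_increment_exponential_regime (x t : R) : 0 <= t -> a <= x ->
  a * `|g (x + t) - g x| <= t.
Proof.
have [[a0 K1] Ka] := (a_gt0, K_ge1, K_geV).
move=> t0 ax.
rewrite mulrC -ler_pdivlMr//.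
apply: (@stein_norm_le_right _ _ _ S' _ _ (cst (t / a)) (cst 0) x (g_incr t0)) => //.
  by move=> y _; rewrite /= divr_ge0// ltW.
move=> y xy; rewrite !min_r; [|lra..].
rewrite subrr mul0r addr0 (le_trans (phi_lip _ _))//.
rewrite addrC addKr ger0_norm//= subr0 mulrC divfK//; lra.
Qed.

(** The bound of [stein_bound_exponential_regime] is of order [a^-2] for small
[a]. Continuing the Gaussian bound by the slope [a^-1] keeps the order at
[K] on the unit interval after [a], which steps across [a] may enter. *)
Lemma stein_bound_past_threshold (x : R) : x <= a + 1 -> `|g x| <= 12 * (1 + K).
Proof.
have [[a0 K1] Ka] := (a_gt0, K_ge1, K_geV).
move=> xa1; have [xa|ax] := leP x a.
  by apply: le_trans (stein_bound_gaussian_regime xa) _; lra.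
have := @stein_increment_exponential_regime a (x - a); rewrite subrKC => H.
have {}H : `|g x - g a| <= a^-1.
  rewrite -[a^-1]mul1r ler_pdivlMr// mulrC (le_trans (H _ _))//; lra.
have := stein_bound_gaussian_regime (lexx a).
have := ler_normD (g x - g a) (g a); rewrite subrK; lra.
Qed.

Lemma source_increment_le (x t : R) : 0 <= t <= 1 ->
  `|phi (x + t) - phi x + (Num.min (x + t) a - Num.min x a) * g (x + t)|
    <= t * (1 + 12 * (1 + K)).
Proof.
have [[a0 K1] Ka] := (a_gt0, K_ge1, K_geV).
move=> /andP[t0 t1].
rewrite mulrDr mulr1 (le_trans (ler_normD _ _))// lerD//.
  by rewrite (le_trans (phi_lip _ _))// addrC addKr ger0_norm.
have [xa|ax] := leP x a; last first.
  rewrite min_r; last by lra.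
  by rewrite subrr mul0r normr0 mulr_ge0//; lra.
rewrite normrM; apply: ler_pM => //; last by apply: stein_bound_past_threshold; lra.
rewrite minEle; case: ifPn => h; rewrite ger0_norm; move: h; rewrite -?ltNge; lra.
Qed.

(** The source of the increment equation is at most a constant [t * C], and the
constant [t * C / `|s x|] is a barrier on the side of [x] away from 0, where
[`|s|] is at least its value at [x]. *)
Lemma stein_increment (x t : R) : 0 <= t <= 1 ->
  `|Num.min x a * (g (x + t) - g x)| <= t * (1 + 12 * (1 + K)).
Proof.
have [[a0 K1] Ka] := (a_gt0, K_ge1, K_geV).
move=> t01; have /andP[t0 t1] := t01.
set C := 1 + 12 * (1 + K); have C0 : 0 <= t * C by rewrite mulr_ge0// /C; lra.
have [x0|x0|->] := ltgtP x 0; last by rewrite min_l ?mul0r ?normr0 //; exact: ltW.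
- rewrite min_l; last by lra.
  rewrite normrM mulrC -ler_pdivlMr ?normr_gt0 ?lt_eqF//.
  apply: (@stein_norm_le_left _ _ _ S' _ _ (cst (t * C / `|x|)) (cst 0) x
    (g_incr t0)) => //.
    by move=> y _; rewrite /= divr_ge0.
  move=> y yx; apply: le_trans (source_increment_le y t01) _.
  rewrite /= sub0r -mulNr mulrCA min_l; last by lra.
  by rewrite ler_peMr// ltr0_norm// ler_pdivlMr; lra.
- have m0 : 0 < Num.min x a by rewrite lt_min x0.
  rewrite normrM mulrC -ler_pdivlMr ?normr_gt0 ?gt_eqF//.
  apply: (@stein_norm_le_right _ _ _ S' _ _ (cst (t * C / `|Num.min x a|))
    (cst 0) x (g_incr t0)) => //.
    by move=> y _; rewrite /= divr_ge0.
  move=> y xy; apply: le_trans (source_increment_le y t01) _.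
  rewrite /= subr0 mulrCA ler_peMr// gtr0_norm// ler_pdivlMr// mul1r.
  by rewrite le_min !ge_min lexx (ltW xy) orbT.
Qed.

(** Here and below, [phi + s g] is the derivative of [g]. *)
Lemma stein_derivative_increment_exponential_regime (x t : R) : 0 <= t -> a <= x ->
  `|(phi (x + t) + Num.min (x + t) a * g (x + t))
    - (phi x + Num.min x a * g x)| <= 2 * t.
Proof.
have [[a0 K1] Ka] := (a_gt0, K_ge1, K_geV).
move=> t0 ax; rewrite !min_r; [|lra..].
have -> : (phi (x + t) + a * g (x + t)) - (phi x + a * g x) =
  (phi (x + t) - phi x) + a * (g (x + t) - g x) by ring.
rewrite (le_trans (ler_normD _ _))// mulrDl mul1r lerD//.
  by rewrite (le_trans (phi_lip _ _))// addrC addKr ger0_norm.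
by rewrite normrM (gtr0_norm a_gt0) stein_increment_exponential_regime.
Qed.

Lemma stein_derivative_increment (x t : R) : 0 <= t <= 1 ->
  `|(phi (x + t) + Num.min (x + t) a * g (x + t))
    - (phi x + Num.min x a * g x)| <= 2 * (1 + 12 * (1 + K)) * t.
Proof.
have [[a0 K1] Ka] := (a_gt0, K_ge1, K_geV).
move=> t01.
have -> : (phi (x + t) + Num.min (x + t) a * g (x + t))
    - (phi x + Num.min x a * g x) =
  (phi (x + t) - phi x + (Num.min (x + t) a - Num.min x a) * g (x + t))
  + Num.min x a * (g (x + t) - g x) by ring.
have -> : 2 * (1 + 12 * (1 + K)) * t
  = t * (1 + 12 * (1 + K)) + t * (1 + 12 * (1 + K)) by ring.
by rewrite (le_trans (ler_normD _ _))// lerD// ?source_increment_le ?stein_increment.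
Qed.

End erlangC_stein_bounds.

(** * Detailed balance of a stationary birth-death chain *)

Section point_mass.
Context (R : realType) (nu : probability nat R).

Definition mass (k : nat) : R := fine (nu [set k]).

Local Notation w := mass.

Lemma fine_prob_set1 (k : nat) : nu [set k] = (w k)%:E.
Proof. by rewrite /mass fineK// fin_num_measure. Qed.

Lemma mass_ge0 (k : nat) : 0 <= w k.
Proof. exact: fine_ge0. Qed.

Lemma sum_mass_le1 (N : nat) : \sum_(k < N) w k <= 1.
Proof.
rewrite -lee_fin -sumEFin.
under eq_bigr do rewrite -fine_prob_set1.
rewrite -(@measure_semi_additive _ _ _ nu (fun k => [set k]) N)//=.
- exact: probability_le1.
- by move=> i j _ _ /= [x [/= -> ->]].
Qed.

Lemma mass_cvg0 : w k @[k --> \oo] --> 0.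
Proof.
apply: cvg_series_cvg_0.
apply: nondecreasing_is_cvgn.
  apply/nondecreasing_seqP => n.
  by rewrite !seriesEnat/= big_nat_recr//= lerDl mass_ge0.
exists 1 => _ [n _ <-]; rewrite seriesEnat /= big_mkord; exact: sum_mass_le1.
Qed.

End point_mass.

Section detailed_balance.
Context (R : realType) (birth death : nat -> R) (death0 : death 0%N = 0).
Context (birth_ge0 : forall i, 0 <= birth i) (death_ge0 : forall i, 0 <= death i).
Context (C : R) (birth_le : forall i, birth i <= C).
Context (p : R -> nat -> nat -> R)
  (p_tr : markov_transition (birth_death_rate birth death) p).
Context (nu : probability nat R) (nu_st : stationary_distribution p nu).

Local Notation w := (mass nu).

(** All terms of the stationarity equation are nonnegative, so any finite part
of the inflow is bounded by the mass. Using only finite sums makes the limit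
[t -> 0] below harmless. *)
Lemma stationary_partial_inflow (t : R) (N j : nat) : 0 <= t ->
  \sum_(i < N) w i * p t i j <= w j.
Proof.
move=> t0; have p0 := transition_ge0 p_tr _ _ t0.
rewrite -lee_fin -fine_prob_set1 (nu_st j t0) -sumEFin.
under eq_bigr do rewrite EFinM -fine_prob_set1.
rewrite -(big_mkord xpredT (fun i => (nu [set i] * (p t i j)%:E)%E)).
by apply: nneseries_lim_ge => i _; rewrite mule_ge0// lee_fin.
Qed.

(** The derivative at time 0 of the previous inequality, which is an equality
at that time once the sum contains the state [j]. *)
Lemma stationary_partial_rate (N j : nat) : (j < N)%N ->
  \sum_(i < N) w i * birth_death_rate birth death i j <= 0.
Proof.
move=> jN.
have lim : \sum_(i < N) w i * ((p t i j - (i == j :> nat)%:R) / t) @[t --> 0^'+] -->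
    \sum_(i < N) w i * birth_death_rate birth death i j.
  apply: cvg_big => [|i _]; [exact: add_continuous|]; apply: cvgM; first exact: cvg_cst.
  exact: (transition_rate p_tr).
apply: (cvgr_to_le lim); near=> t.
have t0 : 0 < t by [].
have -> : \sum_(i < N) w i * ((p t i j - (i == j :> nat)%:R) / t) =
    (\sum_(i < N) w i * p t i j - \sum_(i < N) w i * (i == j :> nat)%:R) / t.
  by rewrite -sumrB mulr_suml; apply: eq_bigr => i _; rewrite mulrA mulrBr.
rewrite [X in _ - X](bigD1 (Ordinal jN))//= eqxx mulr1 [X in _ - (_ + X)]big1 ?addr0.
  by rewrite pmulr_lle0 ?invr_gt0// subr_le0 stationary_partial_inflow// ltW.
by move=> i /negPf; rewrite -val_eqE /= => ->; rewrite mulr0.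
Unshelve. all: by end_near. Qed.

Let D (j : nat) : R := death j.+1 * w j.+1 - birth j * w j.

Let D0_le0 : D 0 <= 0.
Proof.
have := @stationary_partial_rate 2 0 isT.
rewrite !big_ord_recr big_ord0 /= /birth_death_rate /= death0 /D.
lra.
Qed.

Let D_nincr j : D j.+1 <= D j.
Proof.
have := @stationary_partial_rate j.+3 j.+1 (leqnSn _).
rewrite !big_ord_recr /= big1 => [|i _]; last first.
  have ij := ltn_ord i; rewrite /birth_death_rate.
  have -> : (j.+1 == i.+1) = false by lia.
  have -> : (i == j.+2 :> nat) = false by lia.
  have -> : (i == j.+1 :> nat) = false by lia.
  exact: mulr0.
rewrite /birth_death_rate !eqxx !eqSS.
have -> : (j == j.+1) = false by lia.
have -> : (j == j.+2) = false by lia.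
rewrite /D; lra.
Qed.

(** The net flow [D j] from [j + 1] to [j] is nonincreasing in [j] and
nonpositive at 0. As the masses tend to 0 and the birth rates are bounded, it
is also asymptotically nonnegative, hence zero. *)
Lemma stationary_detailed_balance j : death j.+1 * w j.+1 = birth j * w j.
Proof.
have D_le0 i : D i <= 0.
  by elim: i => [|i]; [exact: D0_le0|apply: le_trans (D_nincr i)].
have D_le i : (j <= i)%N -> D i <= D j.
  elim: i => [|i IH]; first by rewrite leqn0 => /eqP ->.
  rewrite leq_eqVlt => /predU1P[<-//|/IH]; exact: le_trans (D_nincr i).
have C_ge0 : 0 <= C := le_trans (birth_ge0 0) (birth_le 0).
suff D_ge0 : 0 <= D j.
  by apply/eqP; rewrite -subr_eq0 eq_le; apply/andP; split; [exact: D_le0|].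
(* [D i] is squeezed between [- C * w i] and [D j] for [i >= j]. *)
have lim : - (C * w i) @[i --> \oo] --> - (C * 0).
  apply: cvgN; apply: cvgM; [exact: cvg_cst|exact: mass_cvg0].
rewrite mulr0 oppr0 in lim.
apply: (cvgr_to_le lim); near=> i.
have ji : (j <= i)%N by near: i; exact: nbhs_infty_ge.
apply: (@le_trans _ _ (D i)).
  have := ler_wpM2r (mass_ge0 nu i) (birth_le i).
  have := mulr_ge0 (death_ge0 i.+1) (mass_ge0 nu i.+1).
  rewrite /D; lra.
exact: D_le.
Unshelve. all: by end_near. Qed.

End detailed_balance.

(** * Moments of the scaled chain *)

(** Turns a bound on the mean of [y * min y a] into one on the mean of [`|y|]
that degrades only like [1 / a]. It serves the chain and the diffusion alike. *)
Lemma norm_le_mul_min (R : realType) (a y : R) : 0 < a ->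
  `|y| <= y * Num.min y a * a^-1 + (1 + y * Num.min y a) / 2.
Proof.
move=> a0; have [ya|ay] := leP y a.
  have : `|y| <= (1 + y * y) / 2.
    have := sqr_ge0 (y + 1); have := sqr_ge0 (y - 1).
    by rewrite ler_norml; move=> h1 h2; apply/andP; split; nra.
  have : 0 <= y * y * a^-1.
    by rewrite mulr_ge0 ?invr_ge0 ?(ltW a0)// -expr2 sqr_ge0.
  lra.
rewrite ger0_norm; last by lra.
rewrite mulfK ?gt_eqF//.
have : 0 <= y * a by rewrite mulr_ge0; lra.
lra.
Qed.

Lemma mul_min_ge0 (R : realType) (a y : R) : 0 < a -> 0 <= y * Num.min y a.
Proof.
move=> a0; have [ya|ay] := leP y a; first by rewrite -expr2 sqr_ge0.
by rewrite mulr_ge0//; lra.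
Qed.

Section discrete_stein.
Context (R : realType) (n : nat) (q : R) (q_ge1 : 1 <= q) (qn : q ^+ 2 < n%:R).
Context (w : nat -> R) (w_ge0 : forall k, 0 <= w k).
Context (w_sum : forall N, \sum_(k < N) w k <= 1).
Context (w_cvg0 : w k @[k --> \oo] --> 0).
Context (w_bal : forall k, (minn k.+1 n)%:R * w k.+1 = q ^+ 2 * w k).

Definition grid (q : R) (k : nat) : R := (k%:R - q ^+ 2) / q.
Definition threshold (n : nat) (q : R) : R := (n%:R - q ^+ 2) / q.

Local Notation x := (grid q).
Local Notation a := (threshold n q).
Local Notation s := (fun k => Num.min (grid q k) (threshold n q)).

Let q_gt0 : 0 < q. Proof. exact: lt_le_trans q_ge1. Qed.

Lemma threshold_gt0 : 0 < a.
Proof. by rewrite /threshold divr_gt0 ?subr_gt0. Qed.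

Lemma gridS k : x k.+1 = x k + q^-1.
Proof. by rewrite /grid -natr1; ring. Qed.

Lemma grid_le_threshold k : (k <= n)%N -> x k <= a.
Proof.
move=> kn; rewrite /grid /threshold ler_wpM2r ?invr_ge0 ?(ltW q_gt0)//.
by rewrite lerB// ler_nat.
Qed.

Lemma grid_ge_threshold k : (n <= k)%N -> a <= x k.
Proof.
move=> kn; rewrite /grid /threshold ler_wpM2r ?invr_ge0 ?(ltW q_gt0)//.
by rewrite lerB// ler_nat.
Qed.

Lemma min_gridE k : s k = ((minn k n)%:R - q ^+ 2) / q.
Proof.
rewrite /=; case: (leqP k n) => kn.
  by rewrite min_l// grid_le_threshold.
by rewrite min_r// grid_ge_threshold// ltnW.
Qed.

(** By detailed balance the sum telescopes. The boundary term is kept, so no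
summability is presupposed. *)
Lemma discrete_stein_identity (G : nat -> R) M :
  \sum_(k < M.+1) w k * (q * (G k.+1 - G k) - s k * G k) = q * w M * G M.+1.
Proof.
have step k : w k * (q * (G k.+1 - G k) - s k * G k)
    = q * w k * G k.+1 - (minn k n)%:R * w k / q * G k.
  by rewrite min_gridE; field; rewrite gt_eqF.
elim: M => [|M IH]; rewrite big_ord_recr /= step.
  by rewrite big_ord0 min0n !mul0r subr0 add0r.
rewrite IH w_bal.
by field; rewrite gt_eqF.
Qed.

Lemma grid_ge0 : \forall k \near \oo, 0 <= x k.
Proof.
near=> k; rewrite /grid divr_ge0 ?(ltW q_gt0)// subr_ge0 (le_trans (ltW qn))//.
by rewrite ler_nat; near: k; exact: nbhs_infty_ge.
Unshelve. all: by end_near. Qed.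

(** The identities are only useful from some index on; nonnegative terms let
the resulting bounds descend to every partial sum. *)
Lemma sum_w_le (F : nat -> R) c N : 0 <= c -> (forall k, 0 <= F k) ->
  (\forall M \near \oo, \sum_(k < M.+1) w k * F k <= c) ->
  \sum_(k < N) w k * F k <= c.
Proof.
move=> c0 F0 [M0 _ HM].
have := HM (maxn M0 N) (leq_maxl _ _).
apply: le_trans; rewrite -!(big_mkord xpredT (fun k => w k * F k)).
rewrite [leRHS](big_cat_nat (n := N))//=; last by rewrite ltnW// ltnS leq_maxr.
by rewrite lerDl sumr_ge0// => k _; rewrite mulr_ge0.
Qed.

(** The Stein identity for the identity function. Its boundary term has a
favourable sign. *)
Lemma grid_second_moment N : \sum_(k < N) w k * (x k * s k) <= 1.
Proof.
apply: (@sum_w_le (fun k => x k * s k)) => //.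
  by move=> k; rewrite mul_min_ge0 ?threshold_gt0.
near=> M.
have H := discrete_stein_identity x M.
have E : \sum_(k < M.+1) w k * (q * (x k.+1 - x k) - s k * x k) =
   \sum_(k < M.+1) w k - \sum_(k < M.+1) w k * (x k * s k).
  rewrite -sumrB; apply: eq_bigr => k _; rewrite gridS; field.
  by rewrite gt_eqF.
have : 0 <= q * w M * x M.+1.
  apply: mulr_ge0; first by rewrite mulr_ge0// ltW.
  by rewrite gridS addr_ge0 ?invr_ge0 ?(ltW q_gt0)//; near: M; exact: grid_ge0.
rewrite -H E => h; have := w_sum M.+1; lra.
Unshelve. all: by end_near. Qed.

Lemma grid_first_moment N : \sum_(k < N) w k * `|x k| <= 1 + a^-1.
Proof.
have a0 := threshold_gt0; have ia0 : 0 < a^-1 by rewrite invr_gt0.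
have norm_le k := norm_le_mul_min (x k) a0.
have H2 := grid_second_moment N.
apply: (@le_trans _ _ 
  (\sum_(k < N) (w k * (x k * s k) * a^-1 + (w k + w k * (x k * s k)) / 2))).
  apply: ler_sum => k _.
  by have := ler_wpM2l (w_ge0 k) (norm_le k); move=> h; apply: le_trans h _; lra.
rewrite big_split /= -!mulr_suml big_split /=.
have := w_sum N; have := ler_wpM2r (ltW ia0) H2; lra.
Qed.

(** The Stein identity for the constant function 1 says that the mean of [s] is
zero, that is, the mean of [a - s] is [a]. *)
Lemma grid_deficit_le N : \sum_(k < N) w k * (a - s k) <= a.
Proof.
have a0 := threshold_gt0.
have v0 k : 0 <= a - s k by rewrite subr_ge0 ge_min lexx orbT.
apply/ler_addgt0Pr => e e0; apply: (@sum_w_le (fun k => a - s k)) => //; first by lra.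
near=> M.
have := discrete_stein_identity (fun=> 1) M.
have -> : \sum_(k < M.+1) w k * (q * (1 - 1) - s k * 1) =
   \sum_(k < M.+1) w k * (a - s k) - (\sum_(k < M.+1) w k) * a.
  by rewrite mulr_suml -sumrB; apply: eq_bigr => k _; ring.
have : q * w M <= e.
  rewrite mulrC -ler_pdivlMr//; near: M.
  by apply: (cvgr_le _ w_cvg0); rewrite divr_gt0.
have := ler_wpM2r (ltW a0) (w_sum M.+1); lra.
Unshelve. all: by end_near. Qed.

(** States with [a - x k > 1] are few by Markov's inequality and
[grid_deficit_le]. The remaining states below [a] are those at which
[G = min (a - s) 1] decreases by exactly [1 / q], so the Stein identity for
[G] counts them. *)
Lemma mass_below_le : \sum_(k < n) w k <= 2 * a.
Proof.
have a0 := threshold_gt0.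
pose v k := a - s k.
have v0 k : 0 <= v k by rewrite subr_ge0 ge_min lexx orbT.
pose G k := Num.min (v k) 1.
have vE k : (k <= n)%N -> v k = a - x k.
  by move=> kn; rewrite /v min_l ?grid_le_threshold.
have one_le k : (k < n)%N -> 1 <= v k + q * (G k - G k.+1).
  move=> kn; have := vE k.+1 kn; have := vE k (ltnW kn); rewrite gridS => vk vk1.
  have iq : 0 < q^-1 by rewrite invr_gt0.
  have vS : v k.+1 = v k - q^-1 by rewrite vk vk1; ring.
  have := v0 k.+1; rewrite /G; have [v1|v1] := leP (v k) 1.
    rewrite min_l vS; last by lra.
    by rewrite subKr divff ?gt_eqF// lerDr.
  move=> _; have : 0 <= q * (1 - Num.min (v k.+1) 1).
    by rewrite mulr_ge0 ?(ltW q_gt0)// subr_ge0 ge_min lexx orbT.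
  lra.
have n_gt0 : (0 < n)%N by rewrite -(ltr_nat R) (le_lt_trans _ qn)// sqr_ge0.
have Gn : G n = 0 by rewrite /G vE// subrr min_l.
have := discrete_stein_identity G n.-1; rewrite prednK// Gn mulr0 => id0.
apply: (@le_trans _ _ (\sum_(k < n) w k * (v k + v k))).
  rewrite -subr_ge0 -[X in 0 <= X]subr0 -[X in _ - X]id0 -!sumrB.
  apply: sumr_ge0 => k _.
  have -> : w k * (v k + v k) - w k - w k * (q * (G k.+1 - G k) - s k * G k)
    = w k * (v k + q * (G k - G k.+1) - 1) + w k * (v k - (v k - a) * G k).
    by rewrite /v; ring.
  rewrite addr_ge0// mulr_ge0// ?subr_ge0 ?one_le//.
  have G0 : 0 <= G k by rewrite /G le_min v0/=.
  have G1 : G k <= 1 by rewrite /G ge_min lexx orbT.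
  have := v0 k; nra.
have := grid_deficit_le n; rewrite -/v => h.
by rewrite mulr2n; under eq_bigr do rewrite mulrDr; rewrite big_split /=; lra.
Qed.

End discrete_stein.

(** * Mean of a centred Lipschitz function under the scaled chain *)

Section grid_comparison.
Context (R : realType) (n : nat) (q : R) (q_ge1 : 1 <= q) (qn : q ^+ 2 < n%:R).
Context (w : nat -> R) (w_ge0 : forall k, 0 <= w k).
Context (w_sum : forall N, \sum_(k < N) w k <= 1).
Context (w_cvg0 : w k @[k --> \oo] --> 0).
Context (w_bal : forall k, (minn k.+1 n)%:R * w k.+1 = q ^+ 2 * w k).

Local Notation x := (grid q).
Local Notation a := (threshold n q).

Context (g phi : R -> R).
Context (g_sol : stein_solution (fun y => Num.min y a) (potential a) g phi).
Context (phi_lip : forall y z, `|phi y - phi z| <= `|y - z|).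
Context (phi_le : forall y, `|phi y| <= `|y| + (1 + a^-1)).

(** By the mean value theorem the secant slope is [g'] at an intermediate
point. *)
Lemma stein_secant_le (y L : R) :
  (forall t : R, 0 <= t <= q^-1 ->
    `|(phi (y + t) + Num.min (y + t) a * g (y + t)) -
      (phi y + Num.min y a * g y)| <= L * t) ->
  `|q * (g (y + q^-1) - g y) - (phi y + Num.min y a * g y)| <= L / q.
Proof.
move=> drift_le.
have q_gt0 : 0 < q := lt_le_trans ltr01 q_ge1.
have iq : 0 < q^-1 by rewrite invr_gt0.
have [g' _] := g_sol.
have gc : {within `[y, y + q^-1], continuous g}.
  apply: continuous_subspaceT => z.
  exact/differentiable_continuous/derivable1_diffP.
have yq : y < y + q^-1 by rewrite ltrDl.
have [z zI ->] := MVT yq (fun z _ => g' z) gc.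
rewrite [y + q^-1 - y]addrAC subrr add0r [q * _]mulrC divfK ?gt_eqF//.
move: zI; rewrite in_itv/= => /andP[yz zy].
have L_ge0 : 0 <= L.
  rewrite -(pmulr_lge0 _ iq) (le_trans _ (drift_le q^-1 _))// lexx andbT ltW//.
have := drift_le (z - y); rewrite subrKC => H.
apply: le_trans (H _) _; first by apply/andP; split; lra.
by rewrite ler_wpM2l//; lra.
Qed.

Definition secant_error (k : nat) : R :=
  q * (g (x k.+1) - g (x k)) - (phi (x k) + Num.min (x k) a * g (x k)).

(** The Lipschitz constant of [g'] below the threshold, for [K = 1 + a^-1]. *)
Definition derivative_lipschitz : R := 2 * (1 + 12 * (1 + (1 + a^-1))).

Local Notation e := secant_error.
Local Notation L := derivative_lipschitz.

Lemma secant_error_le (k : nat) :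
  `|e k| <= (if (k < n)%N then L else 2) / q.
Proof.
have a0 := threshold_gt0 q_ge1 qn.
have q_gt0 : 0 < q := lt_le_trans ltr01 q_ge1.
have ia0 : 0 < a^-1 by rewrite invr_gt0.
rewrite /secant_error gridS; case: ltnP => kn; apply: stein_secant_le => t /andP[t0 tq].
  apply: (@stein_derivative_increment _ _ a0 (1 + a^-1)) => //; [lra|lra|].
  rewrite t0 (le_trans tq)// invf_le1//.
apply: (@stein_derivative_increment_exponential_regime _ _ a0 (1 + a^-1)) => //; [lra|lra|].
exact: grid_ge_threshold.
Qed.

(** The Lipschitz constant [50 + 24 / a] is charged only to the states below
[a], whose mass is at most [min 1 (2 a)]. The product is at most 98 whether
[a] is small or large, and the other states contribute 2. *)
Lemma weighted_secant_error_le N : \sum_(k < N) w k * `|e k| <= 100 / q.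
Proof.
have a0 := threshold_gt0 q_ge1 qn.
have q_gt0 : 0 < q := lt_le_trans ltr01 q_ge1.
have iq : 0 < q^-1 by rewrite invr_gt0.
have ia0 : 0 < a^-1 by rewrite invr_gt0.
have L0 : 0 <= L by rewrite /derivative_lipschitz; lra.
pose b k : R := if (k < n)%N then w k else 0.
have b0 k : 0 <= b k by rewrite /b; case: ifP.
apply: (@le_trans _ _ (\sum_(k < N) (2 * w k + L * b k) / q)).
  apply: ler_sum => k _; have := ler_wpM2l (w_ge0 k) (secant_error_le k).
  rewrite /b mulrA; move=> /le_trans; apply; rewrite ler_pM2r//.
  have := mulr_ge0 L0 (w_ge0 k); have := w_ge0 k; case: ifP => _; lra.
rewrite -mulr_suml ler_pM2r// big_split /= -!mulr_sumr.
have bn : \sum_(k < N) b k <= \sum_(k < n) w k.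
  rewrite -(big_mkord xpredT b) -(big_mkord xpredT w).
  have -> : \sum_(0 <= k < n) w k = \sum_(0 <= k < n) b k.
    by apply: eq_big_nat => k /andP[_ kn]; rewrite /b kn.
  have [Nn|nN] := leqP N n.
    by rewrite [leRHS](big_cat_nat (n := N))//= lerDl sumr_ge0.
  rewrite (big_cat_nat (n := n))//=; last exact: ltnW.
  rewrite gerDl big_nat big1// => k /andP[nk _].
  by rewrite /b ltnNge nk.
have b1 := le_trans bn (w_sum n).
have b2 := le_trans bn (mass_below_le q_ge1 qn w_ge0 w_sum w_cvg0 w_bal).
have := w_sum N.
have Lb : L * \sum_(k < N) b k <= 98.
  move: b1 b2; set z := \sum_(k < N) _ => b1 b2.
  have : a^-1 * z <= 2.
    by have := ler_wpM2l (ltW ia0) b2; rewrite mulrCA mulVf ?gt_eqF// mulr1.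
  rewrite /derivative_lipschitz; lra.
lra.
Qed.

Lemma grid_sum_source_le M :
  `|\sum_(k < M.+1) w k * phi (x k)| <= 100 / q + q * (w M * `|g (x M.+1)|).
Proof.
have q_gt0 : 0 < q := lt_le_trans ltr01 q_ge1.
have -> : \sum_(k < M.+1) w k * phi (x k) =
    q * w M * g (x M.+1) - \sum_(k < M.+1) w k * e k.
  rewrite -(discrete_stein_identity q_ge1 w_bal (g \o x) M) -sumrB.
  by apply: eq_bigr => k _; rewrite /secant_error /=; ring.
rewrite addrC (le_trans (ler_normD _ _))// normrN lerD//.
  rewrite (le_trans (ler_norm_sum _ _ _))//.
  under eq_bigr do rewrite normrM ger0_norm//.
  exact: weighted_secant_error_le.
by rewrite -mulrA normrM (gtr0_norm q_gt0) normrM (ger0_norm (w_ge0 M)).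
Qed.

Lemma mass_norm_grid_cvg0 : w k * `|x k| @[k --> \oo] --> 0.
Proof.
apply: cvg_series_cvg_0; apply: nondecreasing_is_cvgn.
  apply/nondecreasing_seqP => m.
  by rewrite !seriesEnat/= big_nat_recr//= lerDl mulr_ge0.
exists (1 + a^-1) => _ [m _ <-]; rewrite seriesEnat /= big_mkord.
exact: grid_first_moment.
Qed.

(** [g] grows at most linearly and the first moment is finite. *)
Lemma boundary_cvg0 : q * (w k * `|g (x k.+1)|) @[k --> \oo] --> 0.
Proof.
have a0 := threshold_gt0 q_ge1 qn.
have q_gt0 : 0 < q := lt_le_trans ltr01 q_ge1.
have ia0 : 0 < a^-1 by rewrite invr_gt0.
have iq : 0 < q^-1 by rewrite invr_gt0.
pose B := (q^-1 + (1 + a^-1)) / a + a^-2.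
apply: (@squeeze_cvgr _ _ _ _ (cst 0) (fun k => q * (w k * `|x k| * a^-1 + w k * B))).
- near=> k; rewrite mulr_ge0 ?(ltW q_gt0) ?mulr_ge0//=.
  rewrite ler_pM2l// mulrAC -mulrA -mulrDr ler_wpM2l//.
  have nk : (n <= k)%N by near: k; exact: nbhs_infty_ge.
  have ax := grid_ge_threshold q_ge1 nk.
  have h := @stein_bound_exponential_regime _ _ a0 (1 + a^-1) _ _ g phi
    g_sol phi_le (x k.+1).
  rewrite (ger0_norm (x := x k)); last by lra.
  rewrite gridS in h *.
  apply: le_trans (h _ _ _) _; [lra|lra|lra|].
  by rewrite /B le_eqVlt; apply/orP; left; apply/eqP; ring.
- exact: cvg_cst.
- rewrite -[X in _ --> X](mulr0 q); apply: cvgM; first exact: cvg_cst.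
  rewrite -[X in _ --> X](addr0 0); apply: cvgD.
    rewrite -[X in _ --> X](mul0r a^-1); apply: cvgM; last exact: cvg_cst.
    exact: mass_norm_grid_cvg0.
  by rewrite -[X in _ --> X](mul0r B); apply: cvgM; last exact: cvg_cst.
Unshelve. all: by end_near. Qed.

Lemma grid_mean_source_le (l : R) :
  \sum_(k < N) w k * phi (x k) @[N --> \oo] --> l -> `|l| <= 100 / q.
Proof.
move=> sum_l.
have sumS_l : \sum_(k < N.+1) w k * phi (x k) @[N --> \oo] --> l.
  by rewrite (cvg_shiftS (fun N => \sum_(k < N) w k * phi (x k))).
have lim : 100 / q + q * (w N * `|g (x N.+1)|) -
    `|\sum_(k < N.+1) w k * phi (x k)| @[N --> \oo] --> 100 / q + 0 - `|l|.
  apply: cvgB; last exact: cvg_norm.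
  by apply: cvgD; [exact: cvg_cst|exact: boundary_cvg0].
rewrite -subr_ge0 -[100 / q]addr0; apply: (cvgr_to_ge lim).
by near=> N; rewrite subr_ge0 grid_sum_source_le.
Unshelve. all: by end_near. Qed.

End grid_comparison.

(** * Integration against a density *)

Section density.
Context (R : realType) (m : probability (measurableTypeR R) R) (f : R -> R).
Context (f_ge0 : forall x, 0 <= f x) (f_meas : measurable_fun [set: R] f).
Context (mE : forall A : set R, measurable A ->
  m A = (\int[lebesgue_measure]_(x in A) (f x)%:E)%E).

Lemma density_dominates : m `<< lebesgue_measure.
Proof.
apply/null_content_dominatesP => A mA A0; rewrite mE//.
apply: null_set_integral => //.
by apply: measurable_funTS; apply/measurable_EFinP.
Qed.

(** The given density agrees almost everywhere with the Radon-Nikodym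
derivative, for which change of variables is known. *)
Lemma ge0_integral_density (phi : R -> \bar R) (A : set R) : measurable A ->
  measurable_fun setT phi -> (forall x, 0 <= phi x)%E ->
  (\int[m]_(x in A) phi x = \int[lebesgue_measure]_(x in A) (phi x * (f x)%:E))%E.
Proof.
move=> mA mphi phi0.
have mf : measurable_fun setT (EFin \o f) by exact/measurable_EFinP.
have dom := density_dominates.
rewrite -(@Radon_Nikodym_SigmaFinite.change_of_variables _ _ R m lebesgue_measure
  dom)//; last exact: measurable_funTS.
have gi := @Radon_Nikodym_SigmaFinite.f_integrable _ _ R m lebesgue_measure dom.
have mg := measurable_int _ gi.
have ae : ae_eq lebesgue_measure A
    (Radon_Nikodym_SigmaFinite.f m lebesgue_measure) (EFin \o f).
  apply: integral_ae_eq => //.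
  - exact: integrableS gi.
  - exact: measurable_funTS.
  - move=> B BA mB; rewrite [RHS](_ : _ = m B); last exact/esym/mE.
    by rewrite [RHS](Radon_Nikodym_SigmaFinite.f_integral dom).
apply: ge0_ae_eq_integral => //.
- by apply: measurable_funTS; exact: emeasurable_funM.
- by apply: measurable_funTS; exact: emeasurable_funM.
- by move=> x _; rewrite mule_ge0// Radon_Nikodym_SigmaFinite.f_ge0.
- by move=> x _; rewrite mule_ge0// lee_fin.
- exact: ae_eqe_mul2l.
Qed.

Lemma integrable_density (phi : R -> R) : measurable_fun [set: R] phi ->
  m.-integrable setT (EFin \o phi) ->
  lebesgue_measure.-integrable [set: R] (EFin \o (fun x => phi x * f x)).
Proof.
move=> mphi /integrableP[_ phi_fin]; apply/integrableP; split.
  by apply/measurable_EFinP; exact: measurable_funM.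
rewrite (@ge0_integral_density (fun x => `|(phi x)%:E|)%E) in phi_fin => //.
  rewrite (le_lt_trans _ phi_fin)// le_eqVlt; apply/orP; left; apply/eqP.
  by apply: eq_integral => x _; rewrite /= normrM (ger0_norm (f_ge0 x)).
by apply: measurableT_comp => //; exact/measurable_EFinP.
Qed.

(** Writing [phi] as [(phi + `|phi|) - `|phi|] reduces to nonnegative
functions. *)
Lemma integral_density (phi : R -> R) : measurable_fun [set: R] phi ->
  m.-integrable setT (EFin \o phi) ->
  (\int[m]_x (phi x)%:E = \int[lebesgue_measure]_x (phi x * f x)%:E)%E.
Proof.
move=> mphi phi_int.
have abs_int := integrable_norm phi_int.
have mabs : measurable_fun [set: R] (fun x => `|phi x|) by exact: measurableT_comp.
have sum_int : m.-integrable setT (EFin \o (fun x => phi x + `|phi x|)).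
  exact: (integrableD measurableT phi_int abs_int).
have split x : phi x = (phi x + `|phi x|) - `|phi x| by rewrite addrK.
under eq_integral do rewrite split EFinB.
under [RHS]eq_integral do rewrite split mulrBl EFinB.
have mD : measurable_fun [set: R] (fun x => phi x + `|phi x|).
  exact: measurable_funD.
rewrite integralB_EFin//.
rewrite [RHS]integralB_EFin//; last 2 first.
- exact: (integrable_density mD sum_int).
- exact: (integrable_density mabs abs_int).
congr (_ - _)%E.
- rewrite (@ge0_integral_density (fun x => (phi x + `|phi x|)%:E))//.
  + exact/measurable_EFinP.
  + move=> x; rewrite lee_fin; have := ler_norm (- phi x); rewrite normrN; lra.
- rewrite (@ge0_integral_density (fun x => `|phi x|%:E))//.
  exact/measurable_EFinP.
Qed.

End density.

Section tail.
Context (R : realType) (psi : R -> R).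
Context (psi_int : lebesgue_measure.-integrable [set: R] (EFin \o psi)).
Context (psi_mean0 : \int[lebesgue_measure]_x psi x = 0).

(** On the left the integral over the tail is small; on the right it is, up to
sign, the integral over the other tail because the total is zero. In both cases
the tail avoids a symmetric interval carrying almost all of the mass of
[`|psi|]. *)
Lemma vanishes_cumulative_integral :
  vanishes (fun x => \int[lebesgue_measure]_(y in `]-oo, x]) psi y).
Proof.
have intS (A : set (measurableTypeR R)) : measurable A ->
    lebesgue_measure.-integrable A (EFin \o psi).
  by move=> mA; exact: integrableS psi_int.
have norm_int (A : set (measurableTypeR R)) : measurable A ->
    lebesgue_measure.-integrable A (EFin \o (fun y => `|psi y|)).
  by move=> mA; exact: (integrable_norm (intS A mA)).
pose F (N : nat) : set R := `[- N%:R, N%:R]%classic.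
pose I := \int[lebesgue_measure]_y `|psi y|.
have I_fin : (\int[lebesgue_measure]_y `|psi y|%:E)%E = I%:E.
  by rewrite fineK// integrable_fin_num// norm_int.
have mF N : measurable (F N) by exact: measurable_itv.
have FI : \int[lebesgue_measure]_(y in F N) `|psi y| @[N --> \oo] --> I.
  have UF : \bigcup_N F N = setT.
    rewrite -subTset => y _; exists (Num.bound `|y|) => //=.
    by rewrite /F/= in_itv/= -ler_norml ltW// archi_boundP.
  apply: fine_cvg; rewrite -I_fin -UF.
  apply: ge0_nondecreasing_set_cvg_integral => //.
  - move=> N M NM; apply/subsetPset => y; rewrite /F /= !in_itv/= -!ler_norml.
    by move=> /le_trans; apply; rewrite ler_nat.
  - by move=> N; exact: measurable_int (norm_int _ (mF N)).
have le_I (A : set (measurableTypeR R)) : measurable A ->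
    \int[lebesgue_measure]_(y in A) `|psi y| <= I.
  move=> mA; rewrite /I -(setUCr A) Rintegral_setU//.
  - by rewrite lerDl Rintegral_ge0.
  - exact: measurableC.
  - by rewrite setUCr; exact: norm_int.
  - exact/disj_setPCl.
move=> e e0.
have [N _ HN] := cvgr_ge _ FI (I - e) ltac:(lra).
exists (N%:R + 1) => x Nx.
have small (A : set (measurableTypeR R)) : measurable A -> [disjoint A & F N] ->
    `|\int[lebesgue_measure]_(y in A) psi y| <= e.
  move=> mA AF; apply: le_trans (le_normr_Rintegral mA (intS A mA)) _.
  have : \int[lebesgue_measure]_(y in A `|` F N) `|psi y| <= I.
    apply: le_I; apply: measurableU => //; exact: mF.
  rewrite Rintegral_setU//; last 2 first.
  - exact: mF.
  - by apply: norm_int; apply: measurableU => //; exact: mF.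
  by move=> /lerB /(_ (HN N (leqnn N))); rewrite addrK subKr.
have [x0|x0] := leP x 0.
  apply: small => //.
  apply/disj_setPS => y /= [].
  rewrite !in_itv /= => yx /andP[]; rewrite !bnd_simp => Ny _.
  have := le_trans Ny yx : - N%:R <= x; move: Nx; rewrite ler0_norm//; lra.
have -> : \int[lebesgue_measure]_(y in `]-oo, x]) psi y
    = - \int[lebesgue_measure]_(y in `]x, +oo[) psi y.
  have UT : `]-oo, x]%classic `|` `]x, +oo[%classic = [set: R].
    rewrite -subTset => y _ /=; rewrite !in_itv/= andbT.
    by case: leP => _; [left|right].
  apply/eqP; rewrite -addr_eq0 -Rintegral_setU ?UT ?psi_mean0//.
  apply/disj_setPS => y /= []; rewrite !in_itv/= andbT; lra.
rewrite normrN; apply: small => //.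
apply/disj_setPS => y /= [].
rewrite !in_itv /= => /andP[xy _] /andP[_]; rewrite !bnd_simp => yN.
have := lt_le_trans xy yN : x < N%:R; move: Nx; rewrite gtr0_norm//; lra.
Qed.

End tail.

(** * The stationary law of the diffusion *)

Section diffusion.
Context (R : realType) (a kappa : R) (a_gt0 : 0 < a) (kappa_gt0 : 0 < kappa).

Definition potential_density (x : R) : R := kappa * expR (- potential a x).

Lemma potential_density_gt0 x : 0 < potential_density x.
Proof. by rewrite /potential_density mulr_gt0// expR_gt0. Qed.

Lemma is_derive_potential_density (x : R) :
  is_derive x 1 potential_density (- (Num.min x a * potential_density x)).
Proof.
have Sx := is_derive_potential a x.
rewrite /potential_density; apply: is_derive_eq.
by rewrite /GRing.scale/=; ring.
Qed.

Lemma continuous_potential_density : continuous potential_density.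
Proof.
move=> x; have dx := is_derive_potential_density x.
exact/differentiable_continuous/derivable1_diffP.
Qed.

Lemma continuous_mul_min : continuous (fun y : R => y * Num.min y a).
Proof.
move=> y; apply: cvgM; first exact: cvg_id.
by apply: continuous_min; [exact: cvg_id|exact: cvg_cst].
Qed.

Context (m : probability (measurableTypeR R) R).
Context (mE : forall A : set R, measurable A ->
  m A = (\int[lebesgue_measure]_(x in A) (potential_density x)%:E)%E).

Let potential_density_ge0 x : 0 <= potential_density x.
Proof. exact/ltW/potential_density_gt0. Qed.

Let potential_density_meas : measurable_fun [set: R] potential_density.
Proof. by apply: continuous_measurable_fun; exact: continuous_potential_density. Qed.

(** The derivative of [y * f y], for the density [f], is [f y - y * s y * f y].
Integrated over a symmetric interval, the boundary terms help. *)
Lemma diffusion_truncated_moment_le1 (M : R) : 0 < M ->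
  (\int[lebesgue_measure]_(y in `[(- M)%R, M])
     (y * Num.min y a * potential_density y)%:E <= 1)%E.
Proof.
move=> M0.
have NM : - M < M by lra.
have cd : continuous (fun y : R => y * Num.min y a * potential_density y).
  by move=> y; apply: cvgM; [exact: continuous_mul_min|exact: continuous_potential_density].
have cint (h : R -> R) : continuous h ->
    lebesgue_measure.-integrable `[- M, M] (EFin \o h).
  move=> ch; apply: continuous_compact_integrable; first exact: segment_compact.
  exact: continuous_subspaceT.
pose F (y : R) := y * potential_density y.
have F' (y : R) : is_derive y 1 F
    (potential_density y - y * Num.min y a * potential_density y).
  have dy := is_derive_potential_density y; rewrite /F; apply: is_derive_eq.
  by rewrite /GRing.scale/=; ring.
have cF : continuous F.
  by move=> y; apply: cvgM; [exact: cvg_id|exact: continuous_potential_density].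
have FTC : \int[lebesgue_measure]_(y in `[- M, M])
    (potential_density y - y * Num.min y a * potential_density y) = F M - F (- M).
  rewrite /Rintegral (@continuous_FTC2 _ _ F)//.
  - apply: continuous_subspaceT => y; apply: cvgB; last exact: cd.
    exact: continuous_potential_density.
  - split.
    + by move=> y _; have := F' y => -[].
    + by apply: cvg_at_right_filter; exact: cF.
    + by apply: cvg_at_left_filter; exact: cF.
  - by move=> y _; have := F' y; rewrite derive1E => -[_ ->].
have mass_le1 : \int[lebesgue_measure]_(y in `[- M, M]) potential_density y <= 1.
  rewrite /Rintegral -mE// -lee_fin fineK ?fin_num_measure//.
  exact: probability_le1.
have potential_density_int := cint _ continuous_potential_density.
have cd_int := cint _ cd.
rewrite RintegralB// in FTC.
rewrite -[leLHS]fineK ?integrable_fin_num// lee_fin -/(Rintegral _ _ _).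
have : 0 <= F M - F (- M).
  by rewrite /F mulNr opprK addr_ge0// mulr_ge0// ltW.
by move=> /(lerB mass_le1); rewrite -FTC subKr subr0.
Qed.

Lemma diffusion_second_moment_le1 : (\int[m]_y (y * Num.min y a)%:E <= 1)%E.
Proof.
have cms : measurable_fun [set: R] (fun y => y * Num.min y a).
  by apply: continuous_measurable_fun; exact: continuous_mul_min.
have ge0 (y : R) : 0 <= y * Num.min y a * potential_density y.
  by rewrite mulr_ge0 ?mul_min_ge0.
rewrite (ge0_integral_density potential_density_ge0 potential_density_meas mE)//; last 2 first.
- exact/measurable_EFinP.
- by move=> y; rewrite lee_fin mul_min_ge0.
(* Radii start at 1: the truncated bound needs a nondegenerate interval. *)
pose F (N : nat) : set (measurableTypeR R) := `[- N.+1%:R, N.+1%:R]%classic.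
have mF N : measurable (F N) by exact: measurable_itv.
have UF : \bigcup_N F N = setT.
  rewrite -subTset => y _; exists (Num.bound `|y|) => //=.
  rewrite /F/= in_itv/= -ler_norml ltW// (lt_trans (archi_boundP _))//.
  by rewrite ltr_nat.
have lim : (\int[lebesgue_measure]_(y in F N) (y * Num.min y a * potential_density y)%:E
    @[N --> \oo] --> \int[lebesgue_measure]_y (y * Num.min y a * potential_density y)%:E)%E.
  rewrite -UF; apply: ge0_nondecreasing_set_cvg_integral => //.
  - move=> N M NM; apply/subsetPset => y; rewrite /F /= !in_itv/= -!ler_norml.
    by move=> /le_trans; apply; rewrite ler_nat ltnS.
  - move=> N; apply/measurable_funTS/measurable_EFinP.
    exact: measurable_funM.
  - by move=> N y _; rewrite lee_fin.
apply: (cvge_to_le lim); near=> N.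
exact: diffusion_truncated_moment_le1.
Unshelve. all: by end_near. Qed.

Lemma diffusion_first_moment : (\int[m]_y `|y|%:E <= (1 + a^-1)%:E)%E.
Proof.
have c_ge0 : 0 <= a^-1 + 2^-1 by rewrite addr_ge0 ?invr_ge0// ltW.
have cms : measurable_fun [set: R] (fun y => y * Num.min y a).
  by apply: continuous_measurable_fun; exact: continuous_mul_min.
have ms0 (y : R) : 0 <= y * Num.min y a by rewrite mul_min_ge0.
have mnorm : measurable_fun [set: R] (fun y : R => `|y|%:E).
  by apply/measurable_EFinP; apply: continuous_measurable_fun; exact: norm_continuous.
have mms : measurable_fun [set: R] (fun y : R => (y * Num.min y a)%:E).
  exact/measurable_EFinP.
have mcms : measurable_fun [set: R]
    (fun y : R => (a^-1 + 2^-1)%:E * (y * Num.min y a)%:E)%E.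
  by apply/measurable_EFinP; exact: measurable_funM.
apply: (@le_trans _ _ (\int[m]_y
    ((a^-1 + 2^-1)%:E * (y * Num.min y a)%:E + (2^-1)%:E))%E).
  apply: ge0_le_integral => //.
  - exact: emeasurable_funD.
  - move=> y _; rewrite -EFinM -EFinD lee_fin.
    by apply: le_trans (norm_le_mul_min y a_gt0) _; lra.
rewrite ge0_integralD//; last first.
  by move=> y _; rewrite -EFinM lee_fin mulr_ge0.
rewrite ge0_integralZl//; last by move=> y _; rewrite lee_fin.
have mT : m setT = 1%E by exact: probability_setT.
rewrite integral_cst// [X in (_ + _ * X)%E]mT mule1.
apply: (@le_trans _ _ ((a^-1 + 2^-1)%:E * 1 + 2^-1%:E)%E).
  by rewrite leeD2r// lee_wpmul2l// diffusion_second_moment_le1.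
rewrite mule1 -EFinD lee_fin; lra.
Qed.

(** The solution is the cumulative integral of [phi] against the density,
divided by the density; it decays at both ends because [phi] has mean zero. *)
Lemma exists_stein_solution (phi : R -> R) : continuous phi ->
  m.-integrable setT (EFin \o phi) -> (\int[m]_y (phi y)%:E = 0)%E ->
  exists g, stein_solution (fun y => Num.min y a) (potential a) g phi.
Proof.
move=> phic phi_int phi0.
have mphi : measurable_fun [set: R] phi by exact: continuous_measurable_fun.
pose psi y := phi y * potential_density y.
have psi_int := integrable_density potential_density_ge0 potential_density_meas
  mE mphi phi_int.
have psi0 : \int[lebesgue_measure]_y psi y = 0.
  rewrite /Rintegral.
  by rewrite -(integral_density potential_density_ge0 potential_density_meas mE)// phi0.
pose H x := \int[lebesgue_measure]_(y in `]-oo, x]) psi y.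
have H' (x : R) : is_derive x 1 H (psi x).
  have [] := @continuous_FTC1 R psi -oo%O x (x + 1).
  - by rewrite ltrDl.
  - exact: integrableS psi_int.
  - exact: ltNyr.
  - apply: cvgM; [exact: phic|exact: continuous_potential_density].
  by move=> h1 h2; apply: DeriveDef => //; rewrite -h2 derive1E.
exists (fun x => H x * (expR (potential a x) / kappa)); split.
  move=> x; have Hx := H' x; have Sx := is_derive_potential a x.
  apply: is_derive_eq.
  rewrite /psi /potential_density /GRing.scale/= expRN.
  by field; rewrite !gt_eqF// expR_gt0.
move=> e e0; have ke : 0 < e * kappa by rewrite mulr_gt0.
have [M HM] := vanishes_cumulative_integral psi_int psi0 ke.
exists M => x /HM; rewrite -/(H x) => Hx.
have -> : H x * (expR (potential a x) / kappa) * expR (- potential a x) =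
    H x / kappa.
  by rewrite expRN; field; rewrite !gt_eqF// expR_gt0.
by rewrite normrM normfV (gtr0_norm kappa_gt0) ler_pdivrMr.
Qed.

End diffusion.

(** * Explicit density, and laws on the natural numbers *)

Lemma oriented_integral_FTC (R : realType) (f F : R -> R) (a b : R) :
  continuous f -> (forall x : R, is_derive x 1 F (f x)) ->
  oriented_integral f a b = F b - F a.
Proof.
move=> fc F'.
have FTC (l r : R) : l < r -> \int[lebesgue_measure]_(y in `[l, r]) f y = F r - F l.
  move=> lr; rewrite /Rintegral (@continuous_FTC2 _ _ F)//.
  - exact: continuous_subspaceT.
  - have cF : continuous F.
      by move=> x; exact/differentiable_continuous/derivable1_diffP.
    split; first by move=> y _; have := F' y => -[].
    + by apply: cvg_at_right_filter; exact: cF.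
    + by apply: cvg_at_left_filter; exact: cF.
  - by move=> y _; have := F' y; rewrite derive1E => -[_ ->].
rewrite /oriented_integral; case: ltgtP => [ab|ba|->].
- exact: FTC.
- by rewrite FTC// opprB.
- by rewrite set_itv1 Rintegral_set1 subrr.
Qed.

Lemma driftE (R : realType) (n : nat) (lambda mu y : R) :
  0 < - zeta n lambda mu ->
  drift n lambda mu y = - mu * Num.min y (- zeta n lambda mu).
Proof.
rewrite /drift /neg_part => a0; rewrite (max_l (ltW a0)).
have [ya|ay] := leP y (- zeta n lambda mu).
  by rewrite max_l; [ring|lra].
by rewrite max_r; [ring|lra].
Qed.

Lemma diffusion_densityE (R : realType) (n : nat) (lambda mu kappa x : R) :
  0 < mu -> 0 < - zeta n lambda mu ->
  diffusion_density n lambda mu kappa x = potential_density (- zeta n lambda mu) kappa x.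
Proof.
move=> mu0 a0; set a := - zeta n lambda mu.
rewrite /diffusion_density /potential_density; congr (_ * expR _).
have dE : drift n lambda mu = fun y => - mu * Num.min y a.
  by apply/funext => z; rewrite driftE.
have dc : continuous (drift n lambda mu).
  rewrite dE => y; apply: cvgM; first exact: cvg_cst.
  by apply: (@continuous_min R R id (cst a)); [exact: cvg_id|exact: cvg_cst].
have dF (y : R) : is_derive y 1 (fun y => - mu * potential a y) (drift n lambda mu y).
  by have Sy := is_derive_potential a y; rewrite dE; apply: is_derive_eq.
rewrite (oriented_integral_FTC _ _ dc dF).
have -> : potential a 0 = 0.
  by rewrite /potential max_r ?sub0r ?oppr_le0 1?ltW// expr0n/= !mul0r subrr.
by rewrite mulr0 subr0 mulNr mulrN mulKf ?gt_eqF.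
Qed.

Lemma bigcup_set1T : \bigcup_k [set k] = [set: nat].
Proof. by rewrite -subTset => k _; exists k. Qed.

Lemma trivIset_set1T : trivIset setT (fun k : nat => [set k]).
Proof. by move=> i j _ _ [x [/= -> ->]]. Qed.

Section nat_law.
Context (R : realType) (nu : probability nat R).

Local Notation w := (mass nu).

Lemma integral_set1E (G : nat -> R) (k : nat) :
  (\int[nu]_(i in [set k]) (G i)%:E = (w k * G k)%:E)%E.
Proof.
rewrite (eq_integral (cst (G k)%:E)); last by move=> i; rewrite inE => ->.
by rewrite integral_cst//= EFinM /mass fineK ?fin_num_measure// muleC.
Qed.

Lemma nat_law_integrable (F : nat -> R) (C : R) :
  (forall N, \sum_(k < N) w k * `|F k| <= C) -> nu.-integrable setT (EFin \o F).
Proof.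
move=> sum_le; apply/integrableP; split => //.
apply: (@le_lt_trans _ _ C%:E); last by rewrite ltry.
rewrite -bigcup_set1T ge0_integral_bigcup//=; last exact: trivIset_set1T.
under eq_eseriesr do rewrite (integral_set1E (fun i => `|F i|)).
apply: lime_le; first by apply: is_cvg_nneseries => k _ _; rewrite lee_fin mulr_ge0// mass_ge0.
apply: nearW => N; rewrite sumEFin lee_fin big_mkord; exact: sum_le.
Qed.

Let ge0_nat_law_sum_cvg (G : nat -> R) : (forall k, 0 <= G k) ->
  nu.-integrable setT (EFin \o G) ->
  \sum_(k < N) w k * G k @[N --> \oo] --> \int[nu]_k G k.
Proof.
move=> G0 Gint; apply: (@fine_cvg _ _ _ _ (fun N => (\sum_(k < N) w k * G k)%:E)).
rewrite fineK ?integrable_fin_num//.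
have -> : (\int[nu]_k (G k)%:E = \sum_(k <oo) (w k * G k)%:E)%E.
  rewrite -bigcup_set1T ge0_integral_bigcup//=; last 2 first.
  - by move=> k _; rewrite lee_fin.
  - exact: trivIset_set1T.
  by apply: eq_eseriesr => k _; rewrite integral_set1E.
under eq_fun do rewrite -sumEFin -(big_mkord xpredT (fun k => (w k * G k)%:E)).
by apply: is_cvg_nneseries => k _ _; rewrite lee_fin mulr_ge0// mass_ge0.
Qed.

Lemma nat_law_sum_cvg (F : nat -> R) : nu.-integrable setT (EFin \o F) ->
  \sum_(k < N) w k * F k @[N --> \oo] --> \int[nu]_k F k.
Proof.
move=> Fint; have abs_int := integrable_norm Fint.
have sum_int : nu.-integrable setT (EFin \o (fun k => F k + `|F k|)).
  exact: (integrableD measurableT Fint abs_int).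
have -> : \int[nu]_k F k = \int[nu]_k (F k + `|F k|) - \int[nu]_k `|F k|.
  rewrite -RintegralB//; apply: eq_Rintegral => k _; by rewrite addrK.
have -> : (fun N => \sum_(k < N) w k * F k) =
    (fun N => \sum_(k < N) w k * (F k + `|F k|) - \sum_(k < N) w k * `|F k|).
  by apply/funext => N; rewrite -sumrB; apply: eq_bigr => k _; ring.
apply: cvgB; apply: ge0_nat_law_sum_cvg => // k.
by have := ler_norm (- F k); rewrite normrN; lra.
Qed.

End nat_law.

(** * Lipschitz test functions *)

Lemma Lip1_continuous (R : realType) (h : R -> R) : Lip1 h -> continuous h.
Proof.
move=> hL x; apply/cvgrPdist_le => /= e e0; near=> y.
apply: le_trans (hL x y) _; near: y; exact: cvgr_dist_le.
Unshelve. all: by end_near. Qed.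

Lemma Lip1_norm_le (R : realType) (h : R -> R) (x : R) :
  Lip1 h -> `|h x| <= `|h 0| + `|x|.
Proof.
move=> /(_ x 0); rewrite subr0 => hx.
by have := ler_normD (h x - h 0) (h 0); rewrite subrK; lra.
Qed.

Lemma expectation_distribution (R : realType) d d' (T : measurableType d)
    (T' : measurableType d') (P : probability T R) (X : {RV P >-> T'}) (f : T' -> R) :
  measurable_fun setT f -> (distribution P X).-integrable setT (EFin \o f) ->
  ('E_P[f \o X] = \int[distribution P X]_y (f y)%:E)%E.
Proof.
move=> mf /integrableP[_ f_fin]; rewrite unlock integral_distribution//.
  exact/measurable_EFinP.
apply/integrableP; split.
  by apply/measurable_EFinP; apply: measurableT_comp.
rewrite ge0_integral_distribution// in f_fin.
by apply: measurableT_comp => //; exact/measurable_EFinP.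
Qed.

Section diffusion_stein.
Context (R : realType) (a kappa : R) (a_gt0 : 0 < a) (kappa_gt0 : 0 < kappa).
Context (m : probability (measurableTypeR R) R).
Context (mE : forall A : set R, measurable A ->
  m A = (\int[lebesgue_measure]_(x in A) (potential_density a kappa x)%:E)%E).

Lemma Lip1_integrable_diffusion (h : R -> R) : Lip1 h ->
  m.-integrable setT (EFin \o h).
Proof.
move=> hL.
have mh : measurable_fun [set: R] h.
  by apply: continuous_measurable_fun; exact: Lip1_continuous.
have mnorm : measurable_fun [set: R] (fun y : R => `|y|).
  by apply: continuous_measurable_fun; exact: norm_continuous.
have id_int : m.-integrable setT (EFin \o (fun y : R => `|y|)).
  apply/integrableP; split; first exact/measurable_EFinP.
  under eq_integral do rewrite /= normr_id.
  by rewrite (le_lt_trans (diffusion_first_moment a_gt0 kappa_gt0 mE))// ltry.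
have cst_int : m.-integrable setT (EFin \o cst `|h 0|).
  exact: finite_measure_integrable_cst.
apply: (le_integrable measurableT _ _ (integrableD measurableT cst_int id_int)).
  exact/measurable_EFinP.
move=> y _; rewrite /= lee_fin [leRHS]ger0_norm ?addr_ge0//.
exact: Lip1_norm_le.
Qed.

(** The distance of the mean to the value at 0 is at most the mean distance to
0. *)
Lemma Lip1_mean_dist_le (h : R -> R) : Lip1 h ->
  `|h 0 - \int[m]_y h y| <= 1 + a^-1.
Proof.
move=> hL; have h_int := Lip1_integrable_diffusion hL.
have cst_int : m.-integrable setT (EFin \o cst (h 0)).
  exact: finite_measure_integrable_cst.
have mT : m setT = 1%E by exact: probability_setT.
have -> : h 0 - \int[m]_y h y = \int[m]_y (h 0 - h y).
  rewrite (@RintegralB _ _ _ _ _ (cst (h 0)))//.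
  by rewrite Rintegral_cst// [X in fine X]mT mulr1.
have diff_int : m.-integrable setT (EFin \o (fun y => h 0 - h y)).
  exact: (integrableB measurableT cst_int h_int).
apply: le_trans (le_normr_Rintegral measurableT diff_int) _.
have id_int : m.-integrable setT (EFin \o (fun y : R => `|y|)).
  by apply: Lip1_integrable_diffusion => y z; exact: ler_dist_dist.
apply: (@le_trans _ _ (\int[m]_y `|y|)).
  apply: le_Rintegral => //; first exact: integrable_norm diff_int.
  by move=> y _; have := hL 0 y; rewrite sub0r normrN.
rewrite -lee_fin fineK ?integrable_fin_num//.
have H := diffusion_first_moment a_gt0 kappa_gt0 mE; rewrite (le_trans _ H)//.
Qed.

Lemma Lip1_centered_norm_le (h : R -> R) (y : R) : Lip1 h ->
  `|h y - \int[m]_z h z| <= `|y| + (1 + a^-1).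
Proof.
move=> hL; rewrite -[h y](subrK (h 0)) -addrA (le_trans (ler_normD _ _))// lerD//.
  by have := hL y 0; rewrite subr0.
exact: Lip1_mean_dist_le.
Qed.

Lemma exists_Lip1_stein_solution (h : R -> R) : Lip1 h ->
  exists g, stein_solution (fun y => Num.min y a) (potential a) g
    (fun y => h y - \int[m]_z h z).
Proof.
move=> hL; have h_int := Lip1_integrable_diffusion hL.
have cst_int : m.-integrable setT (EFin \o cst (\int[m]_z h z)).
  exact: finite_measure_integrable_cst.
apply: (exists_stein_solution kappa_gt0 mE).
- move=> y; apply: cvgB; last exact: cvg_cst.
  exact: Lip1_continuous.
- exact: (integrableB measurableT h_int cst_int).
have mT : m setT = 1%E by exact: probability_setT.
rewrite integralB_EFin// integral_cst// [X in (_ - _ * X)%E]mT mule1.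
by rewrite /Rintegral fineK ?integrable_fin_num// subee// integrable_fin_num.
Qed.

End diffusion_stein.

(** * Distance between the two stationary laws *)

Section borel_copy.
Context (R : realType) d (T : measurableType d) (P : probability T R) (Y : {RV P >-> R}).

Lemma measurable_fun_borel_copy : @measurable_fun _ _ T (measurableTypeR R) setT Y.
Proof. by move=> _ B mB; rewrite setTI; exact: (measurable_funPTI Y mB). Qed.

(** The same random variable, seen as taking values in [measurableTypeR R], the
copy of the real line on which [lebesgue_measure] lives; its measurable sets are
the same. *)
Definition borel_copy : {RV P >-> measurableTypeR R} :=
  HB.pack_for {mfun T >-> measurableTypeR R} (Y : T -> measurableTypeR R)
    (@isMeasurableFun.Build _ _ T (measurableTypeR R) Y measurable_fun_borel_copy).

End borel_copy.

Unset Implicit Arguments.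

Theorem theorem1p1 (R : realType) (n : nat) (lambda mu : R)
  (n_ge1 : (1 <= n)%N) (lambda_gt0 : 0 < lambda) (mu_gt0 : 0 < mu)
  (load_ge1 : 1 <= offered_load lambda mu)
  (load_ltn : offered_load lambda mu < n%:R)
  (p : R -> nat -> nat -> R)
  (p_transition : markov_transition (erlangC_rate n lambda mu) p)
  (dX : measure_display) (TX : measurableType dX) (PX : probability TX R)
  (Xinf : {RV PX >-> nat})
  (Xinf_stationary : stationary_distribution p (distribution PX Xinf))
  (dY : measure_display) (TY : measurableType dY) (PY : probability TY R)
  (Yinf : {RV PY >-> R})
  (kappa : R) (kappa_gt0 : 0 < kappa)
  (kappa_normalizing : (\int[lebesgue_measure]_x
     (diffusion_density n lambda mu kappa x)%:E = 1)%E)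
  (Yinf_density : has_density Yinf (diffusion_density n lambda mu kappa)) :
  (wasserstein PX (scaled_count lambda mu \o Xinf) PY Yinf
     <= (190 / Num.sqrt (offered_load lambda mu))%:E)%E.
Proof.
set q := Num.sqrt (offered_load lambda mu).
have q2 : q ^+ 2 = offered_load lambda mu by rewrite sqr_sqrtr//; lra.
have q_ge1 : 1 <= q by rewrite -sqrtr1 ler_wsqrtr.
have qn : q ^+ 2 < n%:R by rewrite q2.
have q_gt0 : 0 < q := lt_le_trans ltr01 q_ge1.
have zetaE : - zeta n lambda mu = threshold n q.
  by rewrite /zeta /threshold q2 -mulNr opprB.
have scaledE : scaled_count lambda mu = grid q.
  by apply/funext => k; rewrite /scaled_count /grid q2.
have a0 : 0 < threshold n q := threshold_gt0 q_ge1 qn.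
pose m := distribution PY (borel_copy Yinf).
have mE (A : set R) : measurable A ->
    m A = (\int[lebesgue_measure]_(x in A) (potential_density (threshold n q) kappa x)%:E)%E.
  move=> mA; rewrite -[LHS]/(distribution PY Yinf A) Yinf_density//.
  by apply: eq_integral => x _; rewrite diffusion_densityE ?zetaE.
pose nu := distribution PX Xinf.
pose w := mass nu.
have death0 : mu * (minn 0 n)%:R = 0 by rewrite min0n mulr0.
have birth_ge0 (i : nat) : 0 <= lambda by exact: ltW.
have death_ge0 i : 0 <= mu * (minn i n)%:R by rewrite mulr_ge0// ltW.
have birth_le (i : nat) : lambda <= lambda by [].
have balance := stationary_detailed_balance death0 birth_ge0 death_ge0 birth_le
  p_transition Xinf_stationary.
have w_ge0 k : 0 <= w k by exact: mass_ge0.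
have w_sum N : \sum_(k < N) w k <= 1 by exact: sum_mass_le1.
have w_cvg0 : w k @[k --> \oo] --> 0 by exact: mass_cvg0.
have w_bal k : (minn k.+1 n)%:R * w k.+1 = q ^+ 2 * w k.
  have := balance k; rewrite q2 /offered_load -/nu -/w => b.
  by rewrite mulrAC -b; field; rewrite gt_eqF.
have grid_moment := grid_first_moment q_ge1 qn w_ge0 w_sum w_bal.
apply: ge_ereal_sup => _ [h hL <-].
set F := fun k => h (grid q k).
have F_int : nu.-integrable setT (EFin \o F).
  apply: (@nat_law_integrable _ _ F (`|h 0| + (1 + (threshold n q)^-1))) => N.
  apply: (@le_trans _ _ (\sum_(k < N) (w k * `|h 0| + w k * `|grid q k|))).
    apply: ler_sum => k _; rewrite -mulrDr ler_wpM2l ?w_ge0//.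
    exact: (Lip1_norm_le (grid q k) hL).
  rewrite big_split /= -mulr_suml; apply: lerD; last exact: grid_moment.
  by apply: ler_piMl => //; exact: w_sum.
have h_int := Lip1_integrable_diffusion a0 kappa_gt0 mE hL.
have EX : ('E_PX[h \o (scaled_count lambda mu \o Xinf)] = \int[nu]_k (F k)%:E)%E.
  by rewrite scaledE; exact: expectation_distribution.
have EY : ('E_PY[h \o Yinf] = \int[m]_y (h y)%:E)%E.
  apply: (@expectation_distribution _ _ _ _ _ _ (borel_copy Yinf)) => //.
  by apply: continuous_measurable_fun; exact: Lip1_continuous.
rewrite EX EY -[X in (X - _)%E]fineK ?integrable_fin_num//.
rewrite -[X in (_ - X)%E]fineK ?integrable_fin_num//.
rewrite -/(Rintegral _ _ _) -/(Rintegral _ _ _).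
rewrite -EFinB abse_EFin lee_fin.
set c := \int[m]_y h y.
have [g g_sol] := exists_Lip1_stein_solution a0 kappa_gt0 mE hL.
have phi_lip y z : `|(h y - c) - (h z - c)| <= `|y - z|.
  by rewrite opprB addrA subrK.
have phi_le y : `|h y - c| <= `|y| + (1 + (threshold n q)^-1).
  have := Lip1_centered_norm_le a0 kappa_gt0 mE y hL; exact.
have c_int : nu.-integrable setT (EFin \o cst c).
  exact: finite_measure_integrable_cst.
have Fc_int : nu.-integrable setT (EFin \o (fun k => F k - c)).
  exact: (integrableB measurableT F_int c_int).
have nuT : nu setT = 1%E by exact: probability_setT.
have FcE : \int[nu]_k F k - c = \int[nu]_k (F k - c).
  rewrite (@RintegralB _ _ _ _ _ _ (cst c))//.
  by rewrite Rintegral_cst// [X in fine X]nuT mulr1.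
rewrite FcE.
apply: (@le_trans _ _ (100 / q)); last first.
  by rewrite ler_pM2r ?invr_gt0// ler_nat.
apply: (grid_mean_source_le q_ge1 qn w_ge0 w_sum w_cvg0 w_bal
  g_sol phi_lip phi_le).
exact: nat_law_sum_cvg.
Qed.
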